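(* Any indecomposable $2$-step nilpotent real Lie algebra (of dimension seven) admitting a coclosed $\mathrm{G}_2$-structure also has a coclosed $\mathrm{G}_2$-structure inducing a nilsoliton.
   Context: A Lie algebra is decomposable if it is the direct sum of two (non-zero) ideals, and indecomposable otherwise. It is $2$-step nilpotent if it is non-abelian and $[\mathfrak{g},[\mathfrak{g},\mathfrak{g}]]=0$. $d$ denotes the Chevalley–Eilenberg differential and $e^{ijk}=e^i\wedge e^j\wedge e^k$, etc. A $\mathrm{G}_2$-structure on a $7$-dimensional real Lie algebra $\mathfrak{g}$ is a positive $3$-form $\varphi\in\Lambda^3(\mathfrak{g}^* )$, i.e. one for which there is a coframe $\{e^1,\dots,e^7\}$ of $\mathfrak{g}^*$ with $\varphi=e^{127}+e^{347}+e^{567}+e^{135}-e^{146}-e^{236}-e^{245}$. It determines (induces) the inner product $g_\varphi=\sum_i(e^i)^2$ and the orientation $e^{1\cdots7}$, and its Hodge dual is $\phi=\star_\varphi\varphi=e^{1234}+e^{1256}+e^{1367}+e^{1457}+e^{2357}-e^{2467}+e^{3456}$. It is coclosed if $d\phi=0$. An inner product $g$ on a nilpotent Lie algebra $\mathfrak{n}$ is a nilsoliton if there are $\lambda\in\mathbb{R}$ and a derivation $D$ of $\mathfrak{n}$ with $Ric(g)=\lambda I+D$, where $Ric(g)$ is the Ricci endomorphism of the corresponding left-invariant metric on the simply connected Lie group with Lie algebra $\mathfrak{n}$. A $\mathrm{G}_2$-structure $\varphi$ induces a nilsoliton if $g_\varphi$ is a nilsoliton. *)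

(* Defs.v *)
From HB Require Import structures.
From mathcomp Require Import all_boot all_order all_algebra.
From mathcomp Require Import reals.
Set Implicit Arguments. Unset Strict Implicit. Unset Printing Implicit Defensive.
Import Order.TTheory GRing.Theory Num.Theory.
Local Open Scope ring_scope.

Section LieAlgebra.
Context {R : realType} {V : vectType R}.
Implicit Types (br : {bilinear V -> V -> V}) (I J : {vspace V}).

Definition is_lie_bracket br : Prop :=
  (forall x, br x x = 0) /\
  (forall x y z, br x (br y z) + br y (br z x) + br z (br x y) = 0).

Definition is_ideal br I : Prop := forall x y, y \in I -> br x y \in I.

Definition decomposable br : Prop :=
  exists I J, [/\ is_ideal br I /\ is_ideal br J, I != 0%VS /\ J != 0%VS,
                  (I + J)%VS = fullv & (I :&: J)%VS = 0%VS].

Definition indecomposable br : Prop := ~ decomposable br.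

Definition two_step_nilpotent br : Prop :=
  (exists x y, br x y != 0) /\ (forall x y z, br x (br y z) = 0).

Definition is_derivation br (D : 'End(V)) : Prop :=
  forall x y, D (br x y) = br (D x) y + br x (D y).

End LieAlgebra.

Section Forms.
Context {R : realType} {V : vectType R}.

(* A cochain is an arbitrary function of k vectors; the elements of
   Lambda^k(V^* ) are the cochains satisfying [is_form]. *)
Definition cochain (k : nat) : Type := ('I_k -> V) -> R.

Definition is_form k (w : cochain k) : Prop :=
  (forall (v : 'I_k -> V) (i : 'I_k) (a : R) (x y : V),
     w [eta v with i |-> a *: x + y] =
       a * w [eta v with i |-> x] + w [eta v with i |-> y]) /\
  (forall (v : 'I_k -> V) (i j : 'I_k), i != j -> v i = v j -> w v = 0).

Definition cons_arg k (x : V) (v : 'I_k -> V) : 'I_k.+1 -> V :=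
  fun p => if unlift ord0 p is Some q then v q else x.

Definition cat_arg k m (u : 'I_k -> V) (v : 'I_m -> V) : 'I_(k + m) -> V :=
  fun p => match split p with inl i => u i | inr j => v j end.

(* (dw)(x_0,..,x_k) = \sum_(i < j) (-1)^(i+j) w([x_i,x_j], x_0,..,x_k) with x_i
   and x_j omitted on the right.  The index i ranges over 'I_k.+1: when i < j,
   [lift j i] has value i, and skipping j and then i omits both arguments. *)
Definition ce_diff (br : {bilinear V -> V -> V}) k (w : cochain k.+1) :
    cochain k.+2 :=
  fun x => \sum_(j < k.+2) \sum_(i < k.+1 | (i < j)%N)
    (-1) ^+ (i + j) *
    w (cons_arg (br (x (lift j i)) (x j)) (fun l : 'I_k => x (lift j (lift i l)))).

(* e^{s_1} /\ .. /\ e^{s_k} for s = [:: s_1; ..; s_k], with indices starting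
   at 1 and the normalisation in which the value is det (e^{s_a} (v_b)). *)
Definition ewedge (e : seq 'Hom(V, R^o)) (s : seq nat) : cochain (size s) :=
  fun v => \det (\matrix_(a, b) ((e`_(nth 0%N s a).-1) (v b) : R)).

Definition is_inner_product (g : V -> V -> R) : Prop :=
  [/\ forall u, scalar (g u), forall u v, g u v = g v u &
      forall u, u != 0 -> 0 < g u u].

(* eta = * w for the metric g with volume form vol, read off in a g-orthonormal
   basis f: eta(v) = \sum_I w(f_I) vol(f_I, v) over the increasing multi-indices
   I of length k.  This does not depend on f (nor on its orientation, as vol is
   given); it is equivalent to a /\ * w = g(a, w) vol for all k-forms a. *)
Definition is_hodge_dual k m (g : V -> V -> R) (vol : cochain (k + m))
    (w : cochain k) (eta : cochain m) : Prop :=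
  exists f : (k + m).-tuple V,
    [/\ basis_of fullv f,
        forall i j : 'I_(k + m), g (tnth f i) (tnth f j) = (i == j)%:R &
        forall v : 'I_m -> V, eta v =
          \sum_(I : {ffun 'I_k -> 'I_(k + m)} |
                 [forall a : 'I_k, forall b : 'I_k, (a < b)%N ==> (I a < I b)%N])
             w (fun a => tnth f (I a)) *
             vol (cat_arg (fun a => tnth f (I a)) v)].

End Forms.
Arguments cochain {R} V k.
Arguments ewedge {R V} e s v.

Section Nilsoliton.
Context {R : realType} {V : vectType R}.
Variables (br : {bilinear V -> V -> V}) (g : V -> V -> R).

(* Tensors on the simply connected Lie group are expressed on left-invariant
   vector fields, on which g is constant; metric compatibility therefore reads
   g(nabla_x y, z) + g(y, nabla_x z) = 0. *)
Definition is_levi_civita (nabla : 'Hom(V, 'End(V))) : Prop :=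
  (forall x y, nabla x y - nabla y x = br x y) /\
  (forall x y z, g (nabla x y) z + g y (nabla x z) = 0).

Definition curvature (nabla : 'Hom(V, 'End(V))) (x y : V) : 'End(V) :=
  (nabla x \o nabla y)%VF - (nabla y \o nabla x)%VF - nabla (br x y).

(* ric(y, z) is the trace of x |-> R(x, y) z. *)
Definition ricci_tensor (nabla : 'Hom(V, 'End(V))) (y z : V) : R :=
  \sum_(i < \dim {:V})
    coord (vbasis {:V}) i (curvature nabla (tnth (vbasis {:V}) i) y z).

Definition is_ricci_endo (Ric : 'End(V)) : Prop :=
  exists2 nabla, is_levi_civita nabla &
    forall y z, g (Ric y) z = ricci_tensor nabla y z.

Definition is_nilsoliton : Prop :=
  is_inner_product g /\
  exists (Ric : 'End(V)) (lambda : R) (D : 'End(V)),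
    [/\ is_ricci_endo Ric, is_derivation br D & Ric = lambda *: \1%VF + D].

End Nilsoliton.

Section G2.
Context {R : realType} {V : vectType R}.
Implicit Types (e : 7.-tuple 'Hom(V, R^o)) (phi : cochain V 3).

Definition g2_model e : cochain V 3 :=
  let E := ewedge e in
  fun v => E [:: 1; 2; 7]%N v + E [:: 3; 4; 7]%N v + E [:: 5; 6; 7]%N v
         + E [:: 1; 3; 5]%N v - E [:: 1; 4; 6]%N v - E [:: 2; 3; 6]%N v
         - E [:: 2; 4; 5]%N v.

Definition is_adapted_coframe phi e : Prop :=
  basis_of fullv e /\ phi =1 g2_model e.

Definition is_G2_structure phi : Prop :=
  is_form phi /\ exists e, is_adapted_coframe phi e.

(* g and vol do not depend on the choice of the adapted coframe. *)
Definition induces phi (g : V -> V -> R) (vol : cochain V 7) : Prop :=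
  exists e, [/\ is_adapted_coframe phi e,
    forall u v, g u v = \sum_(i < 7) (tnth e i u : R) * (tnth e i v : R) &
    vol =1 ewedge e [:: 1; 2; 3; 4; 5; 6; 7]%N].

Definition is_coclosed (br : {bilinear V -> V -> V}) phi : Prop :=
  exists g (vol : cochain V 7) (psi : cochain V 4),
    [/\ induces phi g vol, is_hodge_dual (k := 3) (m := 4) g vol phi psi &
        forall x, ce_diff br psi x = 0].

Definition induces_nilsoliton (br : {bilinear V -> V -> V}) phi : Prop :=
  exists g (vol : cochain V 7), induces phi g vol /\ is_nilsoliton br g.

End G2.

(* Main.v *)
Require Import Defs.
From HB Require Import structures.
From mathcomp Require Import all_boot all_order all_algebra.
From mathcomp Require Import boolp reals ring.
Set Implicit Arguments. Unset Strict Implicit. Unset Printing Implicit Defensive.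
Import Order.TTheory GRing.Theory Num.Theory.
Local Open Scope ring_scope.

(** Let z be the centre.  Indecomposability forces z = [g,g], and counting brackets
    then gives dim z = 1, 2 or 3.

    dim z = 1: the bracket is a symplectic form on a complement of z.  In a Darboux
    basis declared orthonormal, g is the Heisenberg algebra with
    de^7 = e^12 + e^34 + e^56; the metric is a nilsoliton and the standard 4-form is
    closed.

    dim z = 2: there is no coclosed structure.  If z is spanned by p and q, put
    A = psi(q,p,.,.) and u = p x q.  Closedness of psi says that both components w
    of the bracket satisfy w /\ A = 0.  Inserting u, which spans the rest of the
    kernel of A, gives theta /\ A = 0 with theta = w(.,u); contracting with A, where
    A^2 = -|p /\ q|^2 on the complement of p, q, u, gives theta = 0.  So u would be
    central and orthogonal to z.

    dim z = 3: some v in a complement U of z has ad v injective on U/v.  This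
    identifies z with U/v, and the remaining brackets become a 3 x 3 matrix.
    Changing the complement of v in U removes its skew part and a congruence
    diagonalises it with entries mu_i in {0, 1, -1}.  In the resulting basis
      [f1,f2] = z2,       [f1,f3] = z3,       [f1,f4] = z4,
      [f3,f4] = mu_2 z2,  [f4,f2] = mu_3 z3,  [f2,f3] = mu_4 z4,
    declared orthonormal, the metric is a nilsoliton for every choice of signs and
    psi is closed when z is calibrated by phi. *)

(** * Forms in coordinates *)

Section Coordinates.
Context {R : realType} {V : vectType R}.
Implicit Types e : seq 'Hom(V, R^o).

(* Indices start at 0, whereas those of [ewedge] start at 1. *)
Definition crd e (n : nat) (x : V) : R := e`_n x.

Lemma crdD e n x y : crd e n (x + y) = crd e n x + crd e n y.
Proof. by rewrite /crd linearD. Qed.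

Lemma crdZ e n a x : crd e n (a *: x) = a * crd e n x.
Proof. by rewrite /crd linearZ. Qed.

Lemma crdN e n x : crd e n (- x) = - crd e n x.
Proof. by rewrite /crd linearN. Qed.

Lemma crd0 e n : crd e n 0 = 0.
Proof. by rewrite /crd linear0. Qed.

Lemma crd_sum e n I r (P : pred I) (F : I -> V) :
  crd e n (\sum_(i <- r | P i) F i) = \sum_(i <- r | P i) crd e n (F i).
Proof. by rewrite /crd linear_sum. Qed.

(** [det2], [det3] and [det4] are monomial forms evaluated on vectors, expanded so that identities
    between forms become polynomial identities for [ring]. *)
Definition det2 e i j (x y : V) := crd e i x * crd e j y - crd e j x * crd e i y.

Definition det3 e i j k (x y z : V) :=
  crd e i x * det2 e j k y z - crd e j x * det2 e i k y z
  + crd e k x * det2 e i j y z.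

Definition det4 e i j k l (x y z w : V) :=
  crd e i x * det3 e j k l y z w - crd e j x * det3 e i k l y z w
  + crd e k x * det3 e i j l y z w - crd e l x * det3 e i j k y z w.

Lemma det_mx_rec (S : comNzRingType) n (A : 'M[S]_n.+1) :
  \det A = \sum_(i < n.+1) A i ord0 * ((-1) ^+ i * \det (row' i (col' ord0 A))).
Proof.
rewrite (expand_det_col A ord0); apply: eq_bigr => i _.
by rewrite /cofactor addn0.
Qed.

Lemma det_mx33E (S : comNzRingType) (A : 'M[S]_3) F :
  (forall i j, A i j = F (val i) (val j)) ->
  \det A =
    F 0%N 0%N * (F 1%N 1%N * F 2%N 2%N - F 2%N 1%N * F 1%N 2%N)
  - F 1%N 0%N * (F 0%N 1%N * F 2%N 2%N - F 2%N 1%N * F 0%N 2%N)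
  + F 2%N 0%N * (F 0%N 1%N * F 1%N 2%N - F 1%N 1%N * F 0%N 2%N).
Proof.
move=> AF; rewrite !(det_mx_rec, big_ord_recl, big_ord0, det_mx00, mxE, AF) /=.
rewrite /bump /=; ring.
Qed.

(** The arguments are described pointwise, so the lemma applies to any function with these values
    without an appeal to extensionality. *)
Lemma ewedge3 e i j k (v : 'I_3 -> V) x y z :
  (forall p, v p = nth 0 [:: x; y; z] p) ->
  ewedge e [:: i.+1; j.+1; k.+1] v = det3 e i j k x y z.
Proof.
move=> vE; rewrite /ewedge (@det_mx33E _ _
  (fun a b => crd e (nth 0 [:: i; j; k] a) (nth 0 [:: x; y; z] b))).
  by rewrite /= /det3 /det2; ring.
move=> a b; rewrite mxE vE /crd.
by case: a => [[|[|[|]]]].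
Qed.

Lemma ewedge4 e i j k l (v : 'I_4 -> V) x y z w :
  (forall p, v p = nth 0 [:: x; y; z; w] p) ->
  ewedge e [:: i.+1; j.+1; k.+1; l.+1] v = det4 e i j k l x y z w.
Proof.
move=> vE; rewrite /ewedge det_mx_rec !big_ord_recl big_ord0.
set F := (fun a b => crd e (nth 0 [:: i; j; k; l] a) (nth 0 [:: x; y; z; w] b)).
have mE (p q : 'I_4) : (\matrix_(a < 4, b < 4)
   ((e`_(nth 0%N [:: i.+1; j.+1; k.+1; l.+1] a).-1) (v b) : R)) p q = F p q.
  rewrite mxE vE /F /crd.
  by case: p => [[|[|[|[|]]]]].
rewrite !mE.
rewrite (@det_mx33E _ _ (fun a b => F a.+1 b.+1)); last first.
  by move=> p q; rewrite !mxE vE /F /crd /=; case: p => [[|[|[|]]]].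
rewrite (@det_mx33E _ _ (fun a b => F (bump 1 a) b.+1)); last first.
  by move=> p q; rewrite !mxE vE /F /crd /=; case: p => [[|[|[|]]]].
rewrite (@det_mx33E _ _ (fun a b => F (bump 2 a) b.+1)); last first.
  by move=> p q; rewrite !mxE vE /F /crd /=; case: p => [[|[|[|]]]].
rewrite (@det_mx33E _ _ (fun a b => F (bump 3 a) b.+1)); last first.
  by move=> p q; rewrite !mxE vE /F /crd /=; case: p => [[|[|[|]]]].
rewrite /F /bump /= /det4 /det3 /det2; ring.
Qed.

End Coordinates.

Section FormFacts.
Context {R : realType} {V : vectType R}.

(** Transposing puts the vectors in the rows, where multilinearity and alternation of the
    determinant are stated. *)
Lemma ewedge_tr (e : seq 'Hom(V, R^o)) s (v : 'I_(size s) -> V) :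
  ewedge e s v = \det (\matrix_(b, a) crd e (nth 0%N s a).-1 (v b)).
Proof. by rewrite /ewedge -det_tr; congr (\det _); apply/matrixP=> b a; rewrite !mxE. Qed.

Lemma ewedge_is_form (e : seq 'Hom(V, R^o)) s : is_form (ewedge e s).
Proof.
split=> [v i a x y | v i j ij vij]; rewrite !ewedge_tr.
  rewrite -[X in _ = _ + X]mul1r; apply: (@determinant_multilinear _ _ _ _ _ i).
  - by apply/rowP=> b; rewrite !mxE /= eqxx crdD crdZ mul1r.
  - by apply/matrixP=> b c; rewrite !mxE /= eq_sym (negbTE (neq_lift _ _)).
  - by apply/matrixP=> b c; rewrite !mxE /= eq_sym (negbTE (neq_lift _ _)).
by apply: (determinant_alternate ij) => b; rewrite !mxE vij.
Qed.

Lemma is_formD k (u w : cochain V k) :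
  is_form u -> is_form w -> is_form (fun v => u v + w v).
Proof.
move=> [ul ua] [wl wa]; split=> [v i a x y | v i j ij vij].
  by rewrite ul wl; ring.
by rewrite (ua _ _ _ ij vij) (wa _ _ _ ij vij) addr0.
Qed.

Lemma is_formN k (u : cochain V k) : is_form u -> is_form (fun v => - u v).
Proof.
move=> [ul ua]; split=> [v i a x y | v i j ij vij]; first by rewrite ul; ring.
by rewrite (ua _ _ _ ij vij) oppr0.
Qed.

Lemma g2_model_is_form (e : 7.-tuple 'Hom(V, R^o)) : is_form (g2_model e).
Proof.
rewrite /g2_model; do ![apply: is_formD | apply: is_formN];
  exact: (@ewedge_is_form e [:: _; _; _]).
Qed.

Implicit Types e : seq 'Hom(V, R^o).

Definition phi3 e (x y z : V) : R :=
  det3 e 0 1 6 x y z + det3 e 2 3 6 x y z + det3 e 4 5 6 x y z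
  + det3 e 0 2 4 x y z - det3 e 0 3 5 x y z - det3 e 1 2 5 x y z
  - det3 e 1 3 4 x y z.

(** The standard 4-form dual to [phi3]; [is_hodge_dual_psi4] derives it from the definition of the
    Hodge dual. *)
Definition psi4 e (x y z w : V) : R :=
  det4 e 0 1 2 3 x y z w + det4 e 0 1 4 5 x y z w + det4 e 0 2 5 6 x y z w
  + det4 e 0 3 4 6 x y z w + det4 e 1 2 4 6 x y z w - det4 e 1 3 5 6 x y z w
  + det4 e 2 3 4 5 x y z w.

Lemma g2_modelE (e : 7.-tuple 'Hom(V, R^o)) (v : 'I_3 -> V) x y z :
  (forall p, v p = nth 0 [:: x; y; z] p) -> g2_model e v = phi3 e x y z.
Proof. by move=> vE; rewrite /g2_model !(ewedge3 _ _ _ _ vE). Qed.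

End FormFacts.

(** * Dual bases of V and of its dual space *)

Section Frames.
Context {R : realType} {V : vectType R}.
Implicit Types (e : 7.-tuple 'Hom(V, R^o)) (b : 7.-tuple V).

Definition dual_frames b e :=
  (forall i j : 'I_7, crd e i b`_j = (i == j)%:R) /\
  (forall x, x = \sum_(i < 7) crd e i x *: b`_i).

Lemma hom_separates (x : V) : x != 0 -> exists h : 'Hom(V, R^o), h x != 0.
Proof.
move=> x0; have xf : x \in <<vbasis {:V}>>%VS by rewrite (span_basis (vbasisP _)) memvf.
move: (coord_span xf) => xs.
case: (pickP (fun i => coord (vbasis {:V}) i x != 0)) => [i ix | all0].
  by exists (linfun (coord (vbasis {:V}) i : V -> R^o)); rewrite lfunE.
move: x0; rewrite xs big1 ?eqxx // => i _.
by move/negbFE/eqP: (all0 i) ->; rewrite scale0r.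
Qed.

(** Turns an identity between vectors into one between scalars, which [ring] can settle, without
    choosing a basis. *)
Lemma crd_ext (x y : V) : (forall e : seq 'Hom(V, R^o), crd e 0 x = crd e 0 y) -> x = y.
Proof.
move=> xy; apply/eqP; rewrite -subr_eq0; apply: contraT => /hom_separates[h].
by have := xy [:: h]; rewrite /crd /= linearB /= => ->; rewrite subrr eqxx.
Qed.

(** A vector killed by the coframe is killed by every functional, hence is zero. So the coordinate
    map to row vectors is injective, bijective by dimension, and the dual frame consists of the
    preimages of the unit rows. *)
Lemma coframe_dual_exists e : \dim {:V} = 7%N -> basis_of fullv e ->
  exists b, dual_frames b e.
Proof.
move=> dV eb.
pose f : V -> 'rV[R]_7 := fun x => \row_i crd e i x.
have f_lin : linear f.
  by move=> a x y; apply/rowP=> i; rewrite !mxE crdD crdZ.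
pose fL := GRing.isLinear.Build _ _ _ _ f f_lin.
pose F : {linear V -> 'rV[R]_7} := HB.pack f fL.
pose h := linfun F.
have hE x : h x = f x by rewrite lfunE.
have ker0 : lker h == 0%VS.
  apply/lker0P => x y /eqP; rewrite -subr_eq0 -linearB /= hE => /eqP fxy.
  apply/eqP; rewrite -subr_eq0; apply: contraT => nz.
  set w := x - y in fxy nz.
  have ew i : crd e i w = 0.
    case: (ltnP i 7) => [i7|le]; last by rewrite /crd nth_default ?lfunE // size_tuple.
    by move/rowP/(_ (Ordinal i7)): fxy; rewrite !mxE.
  have [g gw] : exists g : 'Hom(V, R^o), g w != 0 by exact: hom_separates.
  case/negP: gw; rewrite (coord_basis eb (memvf g)) sum_lfunE big1 // => i _.
  by rewrite scale_lfunE; move: (ew i); rewrite /crd => ->; rewrite scaler0.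
have imf : limg h = fullv.
  apply/eqP; rewrite eqEdim subvf /= limg_dim_eq ?dV; last by rewrite (eqP ker0) capv0.
  by rewrite dimvf /dim /=.
pose b := [tuple (h^-1)%VF (delta_mx 0 i) | i < 7].
have ebE (i j : 'I_7) : crd e i b`_j = (i == j)%:R.
  have : h b`_j = delta_mx 0 j.
    by rewrite -tnth_nth tnth_mktuple limg_lfunVK // imf memvf.
  by rewrite hE => /rowP/(_ i); rewrite !mxE eqxx.
exists b; split=> // x.
apply: (lker0P ker0); rewrite !hE; apply/rowP=> i; rewrite !mxE crd_sum.
rewrite (bigD1 i) //= crdZ ebE eqxx mulr1 big1 ?addr0 // => j ji.
by rewrite crdZ ebE eq_sym (negbTE ji) mulr0.
Qed.

Lemma basis_dual_exists b : \dim {:V} = 7%N -> basis_of fullv b ->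
  exists e, basis_of fullv e /\ dual_frames b e.
Proof.
move=> dV bb.
pose e := [tuple linfun (coord b i : V -> R^o) | i < 7].
have crdE (i : 'I_7) x : crd e i x = coord b i x.
  by rewrite /crd -tnth_nth tnth_mktuple lfunE.
have d : dual_frames b e.
  split=> [i j|x]; first by rewrite crdE (coord_free _ _ (basis_free bb)) eq_sym.
  by rewrite {1}(coord_basis bb (memvf x)); apply: eq_bigr => i _; rewrite crdE.
exists e; split=> //; rewrite basisEfree subvf size_tuple dimvf.
have -> : (dim 'Hom(V, R^o) <= 7)%N by rewrite -dV dimvf /dim /= /dim /= muln1.
rewrite !andbT.
apply/freeP => k k0 j.
move/lfunP/(_ b`_j): k0; rewrite sum_lfunE zero_lfunE (bigD1 j) //= scale_lfunE.
move: (d.1 j j); rewrite /crd eqxx => -> /=; rewrite big1 ?addr0 => [|i ij].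
  by rewrite /GRing.scale /= mulr1.
rewrite scale_lfunE; move: (d.1 i j); rewrite /crd (negbTE ij) => -> /=.
by rewrite scaler0.
Qed.

End Frames.

(** * The Hodge dual *)

(** A triple of distinct indices is one of six rearrangements of an increasing one. This frees the
    sum in the Hodge dual from its ordering condition, so that each index can be contracted
    separately. *)
Lemma sum3_increasing (R : comNzRingType) n (G : 'I_n -> 'I_n -> 'I_n -> R) :
  (forall a b c, G a b c = G b a c) -> (forall a b c, G a b c = G a c b) ->
  (forall a c, G a a c = 0) ->
  \sum_a \sum_b \sum_c G a b c =
  6%:R * \sum_(I : {ffun 'I_3 -> 'I_n} |
      [forall a : 'I_3, forall b : 'I_3, (a < b)%N ==> (I a < I b)%N])
    G (I (@Ordinal 3 0 isT)) (I (@Ordinal 3 1 isT)) (I (@Ordinal 3 2 isT)).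
Proof.
move=> G12 G23 Gd; pose H (a b c : 'I_n) := if (a < b < c)%N then G a b c else 0.
(* For distinct indices exactly one of the six terms survives; for repeated ones both sides
   vanish. *)
have GE a b c : G a b c =
    H a b c + H a c b + H b a c + H b c a + H c a b + H c b a.
  have Gd' x y : G x y y = 0 by rewrite G12 G23 Gd.
  have Gd'' x y : G x y x = 0 by rewrite G23 Gd.
  have E1 : G a c b = G a b c by rewrite G23.
  have E2 : G b a c = G a b c by rewrite G12.
  have E3 : G b c a = G a b c by rewrite G23.
  have E4 : G c a b = G a b c by rewrite G12.
  have E5 : G c b a = G a b c by rewrite G23.
  rewrite /H {}E1 {}E2 {}E3 {}E4 {}E5.
  have [ab|ab|/val_inj ab] := ltngtP a b; last by subst b; rewrite Gd !if_same !addr0.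
    have [bc|bc|/val_inj bc] := ltngtP b c; last by subst c; rewrite Gd' !if_same !addr0.
      by rewrite (ltn_trans ab bc) ltnNge (ltnW (ltn_trans ab bc)) /= !addr0.
    have [ac|ac|/val_inj ac] := ltngtP a c; last by subst c; rewrite Gd'' /= !addr0.
      by rewrite /= !add0r !addr0.
    by rewrite /= !add0r !addr0.
  have [bc|bc|/val_inj bc] := ltngtP b c; last by subst c; rewrite Gd' !if_same !addr0.
    have [ac|ac|/val_inj ac] := ltngtP a c; last by subst c; rewrite Gd'' /= !addr0.
      by rewrite /= !add0r !addr0.
    by rewrite /= !add0r !addr0.
  by rewrite (ltn_trans bc ab) ltnNge (ltnW (ltn_trans bc ab)) /= !add0r.
have -> : \sum_(I : {ffun 'I_3 -> 'I_n} |
      [forall a : 'I_3, forall b : 'I_3, (a < b)%N ==> (I a < I b)%N])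
    G (I (@Ordinal 3 0 isT)) (I (@Ordinal 3 1 isT)) (I (@Ordinal 3 2 isT))
    = \sum_a \sum_b \sum_c H a b c.
  (* [h] is a bijection from triples to functions on ['I_3]; it turns monotonicity into a < b <
     c. *)
  pose h (t : 'I_n * ('I_n * 'I_n)) : {ffun 'I_3 -> 'I_n} :=
    [ffun i : 'I_3 => nth t.1 [:: t.1; t.2.1; t.2.2] i].
  rewrite (reindex h); last first.
    exists (fun I : {ffun 'I_3 -> 'I_n} =>
      (I (@Ordinal 3 0 isT), (I (@Ordinal 3 1 isT), I (@Ordinal 3 2 isT)))).
      by move=> [a [b c]] _; rewrite !ffunE.
    move=> I _; apply/ffunP => -[[|[|[|//]]] i3]; rewrite ffunE /=;
      by congr (I _); apply: val_inj.
  rewrite big_mkcond /=.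
  under [RHS]eq_bigr => a _ do rewrite pair_bigA /=.
  rewrite [RHS]pair_bigA /=; apply: eq_bigr => -[a [b c]] _.
  rewrite !ffunE /= /H /=; congr (if _ then _ else _).
  apply/forallP/andP => [/(_ _)/forallP F|[ab bc]].
    have := F (@Ordinal 3 0 isT) (@Ordinal 3 1 isT).
    have := F (@Ordinal 3 1 isT) (@Ordinal 3 2 isT).
    by rewrite !ffunE.
  case=> [[|[|[|//]]] i3]; apply/forallP; case=> [[|[|[|//]]] j3]; rewrite !ffunE //=.
  exact: ltn_trans ab bc.
under eq_bigr => a _ do under eq_bigr => b _ do under eq_bigr => c _ do rewrite GE.
under eq_bigr => a _ do under eq_bigr => b _ do rewrite !big_split.
under eq_bigr => a _ do rewrite !big_split.
rewrite !big_split /=.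
set S := \sum_a \sum_b \sum_c H a b c.
have E1 : \sum_a \sum_b \sum_c H a c b = S by apply: eq_bigr => a _; rewrite exchange_big.
have E2 : \sum_a \sum_b \sum_c H b a c = S by rewrite exchange_big.
have E3 : \sum_a \sum_b \sum_c H b c a = S.
  by rewrite exchange_big -E1; apply: eq_bigr => a _; apply: eq_bigr.
have E4 : \sum_a \sum_b \sum_c H c a b = S.
  by under eq_bigr => a _ do rewrite exchange_big /=; rewrite exchange_big.
have E5 : \sum_a \sum_b \sum_c H c b a = S.
  under eq_bigr => a _ do rewrite exchange_big /=.
  by rewrite exchange_big -E1; apply: eq_bigr => a _; rewrite exchange_big; apply: eq_bigr.
rewrite E1 E2 E3 E4 E5; ring.
Qed.

Section Contraction.
Context {R : realType} {V : vectType R}.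
Implicit Types (e : 7.-tuple 'Hom(V, R^o)) (b : 7.-tuple V).

(* The contraction sum_a f_a (x) f_a is the same for all orthonormal bases, which makes
   the sum defining the Hodge dual independent of the basis. *)
Lemma orthonormal_contract e b (f : 7.-tuple V) (s t : V -> R) :
  dual_frames b e ->
  (forall i j : 'I_7, \sum_(k < 7) crd e k (tnth f i) * crd e k (tnth f j) = (i == j)%:R) ->
  scalar s -> scalar t ->
  \sum_a s (tnth f a) * t (tnth f a) = \sum_(a < 7) s b`_a * t b`_a.
Proof.
move=> [_ bE] fO ls lt.
pose A : 'M[R]_7 := \matrix_(i, a) crd e i (tnth f a).
(* Orthonormality gives A^T A = 1, whereas the contraction produces A A^T; the latter is also 1
   because A is square. *)
have ATA : A^T *m A = 1%:M.
  apply/matrixP=> i j; rewrite !mxE -fO; apply: eq_bigr => k _.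
  by rewrite !mxE.
have expand (u : V -> R) : scalar u ->
    \row_a u (tnth f a) = (\row_(i < 7) u b`_i) *m A.
  move=> lu; pose uL := GRing.isLinear.Build _ _ _ _ u lu.
  pose U : {linear V -> R^o} := HB.pack u uL.
  apply/rowP=> a; rewrite !mxE {1}[tnth f a]bE -[u]/(U : V -> R) linear_sum.
  by apply: eq_bigr => i _; rewrite linearZ !mxE mulrC.
have E (w : 'I_7 -> V) : \sum_a s (w a) * t (w a) =
    ((\row_a s (w a)) *m (\row_a t (w a))^T) 0 0.
  by rewrite !mxE; apply: eq_bigr => a _; rewrite !mxE.
rewrite !E !expand // trmx_mul mulmxA -(mulmxA _ A) (mulmx1C ATA) mulmx1 //.
Qed.

Definition trilinear_alternating (T : V -> V -> V -> R) :=
  [/\ forall y z, scalar (fun x => T x y z), forall x z, scalar (fun y => T x y z),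
      forall x y, scalar (fun z => T x y z), forall x z, T x x z = 0
    & forall x y, T x y y = 0].

Lemma alternating12 T x y z : trilinear_alternating T -> T x y z = - T y x z.
Proof.
move=> [l1 l2 _ a _]; apply/eqP; rewrite -addr_eq0.
have := a (1 *: x + y) z; rewrite l1 !l2 !a.
by rewrite /= !mul1r add0r addr0 => ->.
Qed.

Lemma alternating23 T x y z : trilinear_alternating T -> T x y z = - T x z y.
Proof.
move=> [_ l2 l3 _ a]; apply/eqP; rewrite -addr_eq0.
have := a x (1 *: y + z); rewrite l2 !l3 !a.
by rewrite /= !mul1r add0r addr0 => ->.
Qed.

(** Each of the six terms of the determinant picks out one rearrangement of T(b_i,b_j,b_k), and its
    sign cancels against the alternation of T. *)
Lemma contract_det3 b e T (i j k : 'I_7) : dual_frames b e -> trilinear_alternating T ->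
  \sum_a \sum_c \sum_d det3 e i j k b`_(a : 'I_7) b`_(c : 'I_7) b`_(d : 'I_7) *
    T b`_a b`_c b`_d = 6%:R * T b`_i b`_j b`_k.
Proof.
move=> [ebE _] alt.
have C (F : 'I_7 -> R) (m : 'I_7) : \sum_(a < 7) crd e m b`_a * F a = F m.
  rewrite (bigD1 m) //= ebE eqxx mul1r big1 ?addr0 // => a am.
  by rewrite ebE eq_sym (negbTE am) mul0r.
have C3 (l m n : 'I_7) : \sum_a \sum_c \sum_d
   crd e l b`_(a : 'I_7) * crd e m b`_(c : 'I_7) * crd e n b`_(d : 'I_7) * T b`_a b`_c b`_d
   = T b`_l b`_m b`_n.
  rewrite -[RHS](C (fun a => T b`_a b`_m b`_n)); apply: eq_bigr => a _.
  rewrite -(C (fun c => T b`_a b`_c b`_n)) mulr_sumr; apply: eq_bigr => c _.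
  rewrite -(C (fun d => T b`_a b`_c b`_d)) !mulr_sumr; apply: eq_bigr => d _.
  by rewrite !mulrA.
transitivity (T b`_i b`_j b`_k - T b`_i b`_k b`_j - T b`_j b`_i b`_k
  + T b`_j b`_k b`_i + T b`_k b`_i b`_j - T b`_k b`_j b`_i).
  rewrite -(C3 i j k) -(C3 i k j) -(C3 j i k) -(C3 j k i) -(C3 k i j) -(C3 k j i).
  do 3!(rewrite -!sumrB -?big_split -?sumrB -?big_split /= -?sumrB; apply: eq_bigr => ? _).
  by rewrite /det3 /det2; ring.
rewrite (alternating23 b`_i b`_k _ alt) (alternating12 b`_j b`_i _ alt).
rewrite (alternating23 b`_j b`_k _ alt) (alternating12 b`_j b`_i _ alt).
rewrite (alternating12 b`_k b`_i _ alt) (alternating23 b`_i b`_k _ alt).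
rewrite (alternating12 b`_k b`_j _ alt) (alternating23 b`_j b`_k _ alt).
rewrite (alternating12 b`_j b`_i _ alt).
ring.
Qed.

End Contraction.

Section Hodge.
Context {R : realType} {V : vectType R}.
Implicit Types (e : 7.-tuple 'Hom(V, R^o)) (b : 7.-tuple V).

(** The volume form, with its arguments in a list so that three vectors can be put in front of four
    given ones. *)
Definition det7 e (s : seq V) : R := \det (\matrix_(q < 7, p < 7) crd e p (nth 0 s q)).

Lemma det7_linear e (i : 'I_7) (s s' s'' : seq V) a :
  nth 0 s i = a *: nth 0 s' i + nth 0 s'' i ->
  (forall p : 'I_7, p != i -> nth 0 s' p = nth 0 s p /\ nth 0 s'' p = nth 0 s p) ->
  det7 e s = a * det7 e s' + det7 e s''.
Proof.
move=> si sp; rewrite -[det7 e s'']mul1r; apply: (@determinant_multilinear _ _ _ _ _ i).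
- by apply/rowP=> q; rewrite !mxE si crdD crdZ mul1r.
- by apply/matrixP=> p q; rewrite !mxE (sp _ _).1 // eq_sym neq_lift.
- by apply/matrixP=> p q; rewrite !mxE (sp _ _).2 // eq_sym neq_lift.
Qed.

Lemma det7_alternate e (i j : 'I_7) (s : seq V) :
  i != j -> nth 0 s i = nth 0 s j -> det7 e s = 0.
Proof. by move=> ij sij; apply: (determinant_alternate ij) => q; rewrite !mxE sij. Qed.

Notation o7 k := (@Ordinal 7 k isT).

Lemma det7_trilinear e (v : 'I_4 -> V) :
  trilinear_alternating (fun x y z => det7 e ([:: x; y; z] ++ codom v)).
Proof.
split=> [y z a x x'|x z a y y'|x y a z z'|x z|x y].
- by apply: (@det7_linear _ (o7 0)) => // -[[|p] p7].
- by apply: (@det7_linear _ (o7 1)) => // -[[|[|p]] p7].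
- by apply: (@det7_linear _ (o7 2)) => // -[[|[|[|p]]] p7].
- exact: (@det7_alternate _ (o7 0) (o7 1)).
- exact: (@det7_alternate _ (o7 1) (o7 2)).
Qed.

Lemma ewedge_det7 e (u : 'I_3 -> V) (v : 'I_4 -> V) x y z :
  (forall p, u p = nth 0 [:: x; y; z] p) ->
  ewedge e [:: 1; 2; 3; 4; 5; 6; 7]%N (cat_arg u v) = det7 e ([:: x; y; z] ++ codom v).
Proof.
move=> uE; rewrite ewedge_tr; congr (\det _); apply/matrixP=> q p; rewrite !mxE.
have -> : (nth 0%N [:: 1; 2; 3; 4; 5; 6; 7] p).-1 = p.
  by case: p => [[|[|[|[|[|[|[|]]]]]]]].
congr (crd _ _ _); rewrite /cat_arg.
case: (@splitP 3 4 q) => j ->; first by rewrite uE; case: j => [[|[|[|]]]].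
by rewrite codomE /= add0n (nth_map j) ?size_enum_ord // nth_ord_enum.
Qed.

Lemma det_row0_delta (S : comNzRingType) n (A : 'M[S]_n.+1) (a : 'I_n.+1) :
  (forall i, A ord0 i = (i == a)%:R) ->
  \det A = (-1) ^+ a * \det (row' ord0 (col' a A)).
Proof.
move=> Aa; rewrite (expand_det_row A ord0) (bigD1 a) //= Aa eqxx mul1r.
by rewrite /cofactor add0n big1 ?addr0 // => i ia; rewrite Aa (negbTE ia) mul0r.
Qed.

(* [j'] and [k'] are the positions of [j] and [k] once the coordinates [i], then [i] and
   [j], are removed; [l], [m], [n], [o] are the remaining indices. *)
Lemma det7_frame e b (i j k : 'I_7) (j' : 'I_6) (k' : 'I_5) (v : 'I_4 -> V) x y z w
    l m n o :
  dual_frames b e -> (forall p, v p = nth 0 [:: x; y; z; w] p) ->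
  lift i j' = j -> lift i (lift j' k') = k ->
  [seq (lift i (lift j' (lift k' p)) : nat) | p <- [:: @Ordinal 4 0 isT;
     @Ordinal 4 1 isT; @Ordinal 4 2 isT; @Ordinal 4 3 isT]] = [:: l; m; n; o] ->
  det7 e ([:: b`_i; b`_j; b`_k] ++ codom v) =
  (-1) ^+ (i + j' + k') * det4 e l m n o x y z w.
Proof.
move=> [ebE _] vE ij ik lmno.
(* The first three rows are unit vectors; three Laplace expansions remove them together with their
   columns. *)
rewrite /det7 (@det_row0_delta _ _ _ i); last first.
  by move=> p; rewrite !mxE ebE.
rewrite (@det_row0_delta _ _ _ j'); last first.
  move=> p; rewrite !mxE; have /= -> := ebE (lift i p) j.
  by rewrite -ij (inj_eq lift_inj).
rewrite (@det_row0_delta _ _ _ k'); last first.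
  move=> p; rewrite !mxE; have /= -> := ebE (lift i (lift j' p)) k.
  by rewrite -ik !(inj_eq lift_inj).
rewrite !mulrA -!exprD; congr (_ * _).
rewrite -(ewedge4 e l m n o vE) ewedge_tr; congr (\det _).
apply/matrixP=> p q; rewrite !mxE /=.
congr (crd _ _ _).
  case: lmno => <- <- <- <-.
  by case: q => [[|[|[|[|//]]]] q4] /=; do !congr (bump _ _).
by rewrite add0n codomE (nth_map p) ?size_enum_ord // nth_ord_enum.
Qed.

(** By [contract_det3] each of the seven monomials of phi contributes six times a volume with three
    frame vectors inserted, that is, six times the complementary 4-monomial up to sign. *)
Lemma sum_phi3_det7 b e (v : 'I_4 -> V) x y z w :
  dual_frames b e -> (forall p, v p = nth 0 [:: x; y; z; w] p) ->
  \sum_(i < 7) \sum_(j < 7) \sum_(k < 7)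
    phi3 e b`_i b`_j b`_k * det7 e ([:: b`_i; b`_j; b`_k] ++ codom v) =
  6%:R * psi4 e x y z w.
Proof.
move=> be vE; have alt := det7_trilinear e v.
have C i j k := contract_det3 i j k be alt.
have cof (i j k : 'I_7) (j' : 'I_6) (k' : 'I_5) l m n o :=
  @det7_frame e b i j k j' k' v x y z w l m n o be vE.
transitivity (6%:R * (det7 e ([:: b`_0; b`_1; b`_6] ++ codom v)
  + det7 e ([:: b`_2; b`_3; b`_6] ++ codom v)
  + det7 e ([:: b`_4; b`_5; b`_6] ++ codom v)
  + det7 e ([:: b`_0; b`_2; b`_4] ++ codom v)
  - det7 e ([:: b`_0; b`_3; b`_5] ++ codom v)
  - det7 e ([:: b`_1; b`_2; b`_5] ++ codom v)
  - det7 e ([:: b`_1; b`_3; b`_4] ++ codom v))).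
  rewrite !mulrDr !mulrN.
  rewrite -(C (o7 0) (o7 1) (o7 6)) -(C (o7 2) (o7 3) (o7 6)) -(C (o7 4) (o7 5) (o7 6)).
  rewrite -(C (o7 0) (o7 2) (o7 4)) -(C (o7 0) (o7 3) (o7 5)) -(C (o7 1) (o7 2) (o7 5)).
  rewrite -(C (o7 1) (o7 3) (o7 4)).
  do 3!(rewrite -?sumrN -!big_split /=; apply: eq_bigr => ? _).
  by rewrite /phi3; ring.
rewrite (cof (o7 0) (o7 1) (o7 6) (@Ordinal 6 0 isT) (@Ordinal 5 4 isT) 2 3 4 5)%N //; try exact: val_inj.
rewrite (cof (o7 2) (o7 3) (o7 6) (@Ordinal 6 2 isT) (@Ordinal 5 4 isT)
  0 1 4 5)%N //; try exact: val_inj.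
rewrite (cof (o7 4) (o7 5) (o7 6) (@Ordinal 6 4 isT) (@Ordinal 5 4 isT)
  0 1 2 3)%N //; try exact: val_inj.
rewrite (cof (o7 0) (o7 2) (o7 4) (@Ordinal 6 1 isT) (@Ordinal 5 2 isT)
  1 3 5 6)%N //; try exact: val_inj.
rewrite (cof (o7 0) (o7 3) (o7 5) (@Ordinal 6 2 isT) (@Ordinal 5 3 isT)
  1 2 4 6)%N //; try exact: val_inj.
rewrite (cof (o7 1) (o7 2) (o7 5) (@Ordinal 6 1 isT) (@Ordinal 5 3 isT)
  0 3 4 6)%N //; try exact: val_inj.
rewrite (cof (o7 1) (o7 3) (o7 4) (@Ordinal 6 2 isT) (@Ordinal 5 2 isT)
  0 2 5 6)%N //; try exact: val_inj.
rewrite /psi4 /=; ring.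
Qed.

Lemma phi3_trilinear e : trilinear_alternating (phi3 e).
Proof.
by split=> [y z a x x'|x z a y y'|x y a z z'|x z|x y]; rewrite /phi3 /det3 /det2 ?crdD ?crdZ; ring.
Qed.

(** The orthonormal basis [f] in the definition is arbitrary. The sum over increasing indices is
    first made a full sum, in which [f] can be replaced by the frame [b]. *)
Lemma is_hodge_dual_psi4 e b g (vol : cochain V 7) (phi : cochain V 3)
    (f : 7.-tuple V) (v : 'I_4 -> V) x y z w :
  dual_frames b e -> phi =1 g2_model e ->
  (forall u v, g u v = \sum_(i < 7) (tnth e i u : R) * (tnth e i v : R)) ->
  vol =1 ewedge e [:: 1; 2; 3; 4; 5; 6; 7]%N ->
  (forall i j : 'I_7, g (tnth f i) (tnth f j) = (i == j)%:R) ->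
  (forall p, v p = nth 0 [:: x; y; z; w] p) ->
  \sum_(I : {ffun 'I_3 -> 'I_(3 + 4)} |
      [forall a : 'I_3, forall b : 'I_3, (a < b)%N ==> (I a < I b)%N])
    phi (fun a => tnth f (I a)) * vol (cat_arg (fun a => tnth f (I a)) v) = psi4 e x y z w.
Proof.
move=> be phiE gE volE fO vE.
pose G (c d h : 'I_7) := phi3 e (tnth f c) (tnth f d) (tnth f h) *
  det7 e ([:: tnth f c; tnth f d; tnth f h] ++ codom v).
have alt := det7_trilinear e v; have alt' := phi3_trilinear e.
have six : (6%:R : R) != 0 by rewrite pnatr_eq0.
apply: (mulfI six); rewrite -(sum_phi3_det7 be vE).
transitivity (\sum_c \sum_d \sum_h G c d h).
  rewrite (@sum3_increasing _ _ G); last 1 first.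
  - by move=> c h; rewrite /G (let: And5 _ _ _ a _ := alt' in a) mul0r.
  - congr (_ * _); apply: eq_bigr => I _; rewrite phiE volE /G.
    have tE (p : 'I_3) : tnth f (I p) = nth 0 [:: tnth f (I (@Ordinal 3 0 isT));
       tnth f (I (@Ordinal 3 1 isT)); tnth f (I (@Ordinal 3 2 isT))] p.
      by case: p => [[|[|[|]]]] //= p3; congr (tnth f (I _)); apply: val_inj.
    by rewrite (g2_modelE e tE) (ewedge_det7 e v tE).
  - by move=> c d h; rewrite /G (alternating12 _ _ _ alt') (alternating12 _ _ _ alt) mulrNN.
  - by move=> c d h; rewrite /G (alternating23 _ _ _ alt') (alternating23 _ _ _ alt) mulrNN.
have fO' (i j : 'I_7) : \sum_(k < 7) crd e k (tnth f i) * crd e k (tnth f j) = (i == j)%:R.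
  by rewrite -fO gE; apply: eq_bigr => k _; rewrite !(tnth_nth 0).
case: alt alt' => [l1 l2 l3 _ _] [m1 m2 m3 _ _]; rewrite /G.
(* The basis is exchanged one slot at a time, with the sum over that slot moved innermost. *)
under eq_bigr => c _ do under eq_bigr => d _ do
  rewrite (orthonormal_contract be fO' (m3 _ _) (l3 _ _)).
under eq_bigr => c _ do rewrite exchange_big /=.
under eq_bigr => c _ do under eq_bigr => d _ do
  rewrite (orthonormal_contract be fO' (m2 _ _) (l2 _ _)).
rewrite exchange_big /=; under eq_bigr => c _ do rewrite exchange_big /=.
under eq_bigr => c _ do under eq_bigr => d _ do
  rewrite (orthonormal_contract be fO' (m1 _ _) (l1 _ _)).
under eq_bigr => c _ do rewrite exchange_big /=.
rewrite exchange_big /=; apply: eq_bigr => c _; rewrite exchange_big /=.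
by [].
Qed.

End Hodge.

(** * The differential of a 4-form, and coclosedness in a frame *)

Section Differential.
Context {R : realType} {V : vectType R}.
Implicit Types (br : {bilinear V -> V -> V}).

(** The ten terms of the Chevalley-Eilenberg differential, with sign (-1)^(i+j) for positions
    counted from 0. *)
Definition d4 br (P : V -> V -> V -> V -> R) (a b c d f : V) : R :=
  - P (br a b) c d f + P (br a c) b d f - P (br a d) b c f + P (br a f) b c d
  - P (br b c) a d f + P (br b d) a c f - P (br b f) a c d
  - P (br c d) a b f + P (br c f) a b d - P (br d f) a b c.

Lemma ce_diff4E br (psi : cochain V 4) P (v : 'I_5 -> V) a b c d f :
  (forall (u : 'I_4 -> V) x y z w, (forall p, u p = nth 0 [:: x; y; z; w] p) ->
     psi u = P x y z w) ->
  (forall p, v p = nth 0 [:: a; b; c; d; f] p) ->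
  ce_diff br psi v = d4 br P a b c d f.
Proof.
move=> psiE vE; pose s := [:: a; b; c; d; f].
have E (i : 'I_4) (j : 'I_5) :
    psi (cons_arg (br (v (lift j i)) (v j)) (fun l : 'I_3 => v (lift j (lift i l)))) =
    P (br (nth 0 s (bump j i)) (nth 0 s j)) (nth 0 s (bump j (bump i 0)))
      (nth 0 s (bump j (bump i 1))) (nth 0 s (bump j (bump i 2))).
  apply: psiE => p; rewrite /cons_arg.
  by case: unliftP => [q|] -> /=; rewrite !vE //; case: q => [[|[|[|]]]].
rewrite /ce_diff; under eq_bigr => j _ do under eq_bigr => i _ do rewrite E.
under eq_bigr => j _ do rewrite big_mkcond.
rewrite !(big_ord_recl, big_ord0) /= /bump /= /d4; ring.
Qed.

End Differential.

Section Coclosed.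
Context {R : realType} {V : vectType R}.
Implicit Types (br : {bilinear V -> V -> V}).
Implicit Types (e : 7.-tuple 'Hom(V, R^o)) (b : 7.-tuple V).

Lemma crd_frame b e k i : dual_frames b e -> (k < 7)%N -> (i < 7)%N ->
  crd e k b`_i = (k == i)%:R.
Proof. by move=> [be _] k7 i7; rewrite (be (Ordinal k7) (Ordinal i7)). Qed.

Lemma crd_inj b e x y : dual_frames b e ->
  (forall k : 'I_7, crd e k x = crd e k y) -> x = y.
Proof.
by move=> [_ bE] xy; rewrite [x]bE [y]bE; apply: eq_bigr => k _; rewrite xy.
Qed.

Lemma dual_frames_basis b e : \dim {:V} = 7%N -> dual_frames b e -> basis_of fullv b.
Proof.
move=> dV [_ bE]; rewrite basisEdim dV size_tuple leqnn andbT.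
apply/subvP=> x _; rewrite [x]bE; apply: memv_suml => i _.
by apply/memvZ/memv_span/mem_nth; rewrite size_tuple.
Qed.

(** Since the Hodge dual is [psi4] in an adapted coframe, closedness becomes an identity in
    coordinates. *)
Lemma coclosed_frame br (phi : cochain V 3) : \dim {:V} = 7%N -> is_coclosed br phi ->
  exists e b, [/\ dual_frames b e &
    forall v x y z w, d4 br (psi4 e) v x y z w = 0].
Proof.
move=> dV [g [vol [psi [[e [[eb phiE] gE volE]] [f [fb fO psiE]] closed]]]].
have [b be] := coframe_dual_exists dV eb.
exists e, b; split=> // v x y z w.
rewrite -(closed (fun p => nth 0 [:: v; x; y; z; w] p)); symmetry.
apply: ce_diff4E => // u x' y' z' w' uE.
by rewrite psiE (is_hodge_dual_psi4 be phiE gE volE fO uE).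
Qed.

(** Conversely, the dual frame [b] is itself orthonormal and serves as the basis that
    [is_hodge_dual] asks for. *)
Lemma frame_coclosed br e b : \dim {:V} = 7%N -> basis_of fullv e -> dual_frames b e ->
  (forall v x y z w, d4 br (psi4 e) v x y z w = 0) -> is_coclosed br (g2_model e).
Proof.
move=> dV eb be closed.
pose psi : cochain V 4 := fun v =>
  psi4 e (v ord0) (v (@Ordinal 4 1 isT)) (v (@Ordinal 4 2 isT)) (v (@Ordinal 4 3 isT)).
exists (fun u v => \sum_(i < 7) (tnth e i u : R) * (tnth e i v : R)).
exists (ewedge e [:: 1; 2; 3; 4; 5; 6; 7]%N), psi.
have bO (i j : 'I_7) : \sum_(k < 7) (tnth e k (tnth b i) : R) * (tnth e k (tnth b j) : R)
    = (i == j)%:R.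
  rewrite (bigD1 i) //= big1 => [|k ki]; rewrite !(tnth_nth 0) -!/(crd e _ _) !be.1.
    by rewrite eqxx mul1r addr0.
  by rewrite (negbTE ki) mul0r.
have vE (v : 'I_4 -> V) p : v p = nth 0 [:: v ord0; v (@Ordinal 4 1 isT);
    v (@Ordinal 4 2 isT); v (@Ordinal 4 3 isT)] p.
  by case: p => [[|[|[|[|]]]]] //= p4; congr (v _); apply: val_inj.
split; first by exists e.
  exists b; split=> [||v]; [exact: dual_frames_basis dV be | exact: bO |].
  rewrite [LHS]/psi; symmetry.
  by apply: (is_hodge_dual_psi4 be (frefl _) _ (frefl _) bO (vE v)).
move=> v; rewrite (@ce_diff4E _ _ br psi (psi4 e) v (v ord0) (v (@Ordinal 5 1 isT))
  (v (@Ordinal 5 2 isT)) (v (@Ordinal 5 3 isT)) (v (@Ordinal 5 4 isT))) //.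
  by move=> u x y z w uE; rewrite /psi !uE.
by case=> [[|[|[|[|[|]]]]]] //= p5; congr (v _); apply: val_inj.
Qed.

End Coclosed.

(** * No coclosed structure when the centre is a plane *)

Section Obstruction.
Context {R : realType} {V : vectType R}.
Implicit Types (br : {bilinear V -> V -> V}).
Variables (e : 7.-tuple 'Hom(V, R^o)) (b : 7.-tuple V).
Hypothesis be : dual_frames b e.

Definition dot x y := \sum_(i < 7) crd e i x * crd e i y.

Lemma dotE x y : dot x y = crd e 0 x * crd e 0 y + crd e 1 x * crd e 1 y
  + crd e 2 x * crd e 2 y + crd e 3 x * crd e 3 y + crd e 4 x * crd e 4 y
  + crd e 5 x * crd e 5 y + crd e 6 x * crd e 6 y.
Proof. by rewrite /dot !(big_ord_recr, big_ord0) /= add0r. Qed.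

Lemma dot_eq0 x : dot x x = 0 -> x = 0.
Proof.
move=> x0; apply: (crd_inj be) => k; rewrite crd0.
have := psumr_eq0P (fun i _ => sqr_ge0 (crd e (i : 'I_7) x)) x0 (isT : xpredT k).
by move/eqP; rewrite sqrf_eq0 => /eqP.
Qed.

Definition gram p q := dot p p * dot q q - dot p q ^+ 2.

(** The vector -(p.q) p + (p.p) q has squared norm (p.p) times [gram p q]; if it were zero,
    independence would give p.p = 0. *)
Lemma gram_neq0 p q : (forall s t : R, s *: p + t *: q = 0 -> t = 0) -> p != 0 ->
  gram p q != 0.
Proof.
move=> pq p0; apply: contra_neq p0 => g0.
suff : dot p p = 0 by exact: dot_eq0.
apply: (pq (- dot p q)); apply: dot_eq0.
transitivity (dot p p * gram p q); last by rewrite g0 mulr0.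
by rewrite /gram !dotE !(crdD, crdZ); ring.
Qed.

Lemma crd_sum_frame (c : seq R) k : (k < 7)%N ->
  crd e k (\sum_(i < 7) c`_i *: b`_i) = c`_k.
Proof.
move=> k7; rewrite crd_sum (bigD1 (Ordinal k7)) //= crdZ crd_frame //.
rewrite eqxx mulr1 big1 ?addr0 // => i ik; rewrite crdZ crd_frame //.
by rewrite eq_sym (negbTE (_ : (i : nat) != k)) ?mulr0.
Qed.

(* The coordinates of the vector dual to phi(p,q,.). *)
Definition cross_crd p q : seq R := let m i j := det2 e i j p q in
  [:: m 1 6 + m 2 4 - m 3 5;
    - m 0 6 - m 2 5 - m 3 4;
    m 3 6 - m 0 4 + m 1 5;
    - m 2 6 + m 0 5 + m 1 4;
    m 5 6 + m 0 2 - m 1 3;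
    - m 4 6 - m 0 3 - m 1 2;
    m 0 1 + m 2 3 + m 4 5].

Definition cross p q := \sum_(k < 7) (cross_crd p q)`_k *: b`_k.

Lemma crd_cross p q k : (k < 7)%N -> crd e k (cross p q) = (cross_crd p q)`_k.
Proof. exact: crd_sum_frame. Qed.

(* The coordinates of the vector dual to psi(q,p,x,.). *)
Definition contr_crd p q x : seq R := let m i j := det2 e i j q p in
  [:: (- m 2 3 - m 4 5) * crd e 1 x + (m 1 3 - m 5 6) * crd e 2 x
      + (- m 1 2 - m 4 6) * crd e 3 x + (m 1 5 + m 3 6) * crd e 4 x
      + (- m 1 4 + m 2 6) * crd e 5 x + (- m 2 5 - m 3 4) * crd e 6 x;
    (m 2 3 + m 4 5) * crd e 0 x + (- m 0 3 - m 4 6) * crd e 2 x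
      + (m 0 2 + m 5 6) * crd e 3 x + (- m 0 5 + m 2 6) * crd e 4 x
      + (m 0 4 - m 3 6) * crd e 5 x + (- m 2 4 + m 3 5) * crd e 6 x;
    (- m 1 3 + m 5 6) * crd e 0 x + (m 0 3 + m 4 6) * crd e 1 x
      + (- m 0 1 - m 4 5) * crd e 3 x + (- m 1 6 + m 3 5) * crd e 4 x
      + (- m 0 6 - m 3 4) * crd e 5 x + (m 0 5 + m 1 4) * crd e 6 x;
    (m 1 2 + m 4 6) * crd e 0 x + (- m 0 2 - m 5 6) * crd e 1 x
      + (m 0 1 + m 4 5) * crd e 2 x + (- m 0 6 - m 2 5) * crd e 4 x
      + (m 1 6 + m 2 4) * crd e 5 x + (m 0 4 - m 1 5) * crd e 6 x;
    (- m 1 5 - m 3 6) * crd e 0 x + (m 0 5 - m 2 6) * crd e 1 x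
      + (m 1 6 - m 3 5) * crd e 2 x + (m 0 6 + m 2 5) * crd e 3 x
      + (- m 0 1 - m 2 3) * crd e 5 x + (- m 0 3 - m 1 2) * crd e 6 x;
    (m 1 4 - m 2 6) * crd e 0 x + (- m 0 4 + m 3 6) * crd e 1 x
      + (m 0 6 + m 3 4) * crd e 2 x + (- m 1 6 - m 2 4) * crd e 3 x
      + (m 0 1 + m 2 3) * crd e 4 x + (- m 0 2 + m 1 3) * crd e 6 x;
    (m 2 5 + m 3 4) * crd e 0 x + (m 2 4 - m 3 5) * crd e 1 x
      + (- m 0 5 - m 1 4) * crd e 2 x + (- m 0 4 + m 1 5) * crd e 3 x
      + (m 0 3 + m 1 2) * crd e 4 x + (m 0 2 - m 1 3) * crd e 5 x].

Definition contr p q x := \sum_(k < 7) (contr_crd p q x)`_k *: b`_k.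

Lemma crd_contr p q x k : (k < 7)%N -> crd e k (contr p q x) = (contr_crd p q x)`_k.
Proof. exact: crd_sum_frame. Qed.

Lemma psi4_contr p q x y : psi4 e q p x y = dot (contr p q x) y.
Proof.
rewrite dotE !crd_contr // /contr_crd /= /psi4 /det4 /det3 /det2.
ring.
Qed.

Lemma contr_skew p q x y : dot (contr p q x) y = - dot x (contr p q y).
Proof. by rewrite !dotE !crd_contr // /contr_crd /= /det2; ring. Qed.

(** The vector p x q completes p and q to an associative subspace, and psi vanishes once three of
    its arguments lie in one. *)
Lemma contr_cross p q : contr p q (cross p q) = 0.
Proof.
apply: (crd_inj be) => k; rewrite crd_contr // crd0 /contr_crd.
rewrite !crd_cross // /cross_crd /= /det2.
by case: k => [[|[|[|[|[|[|[|]]]]]]]] //= _; ring.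
Qed.

Lemma dot_cross p q : dot (cross p q) (cross p q) = gram p q.
Proof. by rewrite /gram !dotE !crd_cross // /cross_crd /= /det2; ring. Qed.

Lemma dot_crossl p q : dot (cross p q) p = 0.
Proof. by rewrite !dotE !crd_cross // /cross_crd /= /det2; ring. Qed.

Lemma dot_crossr p q : dot (cross p q) q = 0.
Proof. by rewrite !dotE !crd_cross // /cross_crd /= /det2; ring. Qed.

(** Up to the factor |p /\ q| the map [contr p q] is a complex structure on the complement of p, q
    and p x q; the correction terms make the right side vanish on these three vectors. *)
Lemma contr_sqr p q x : contr p q (contr p q x) = - gram p q *: x
  + (dot q q * dot p x - dot p q * dot q x) *: p
  + (dot p p * dot q x - dot p q * dot p x) *: q
  + dot (cross p q) x *: cross p q.
Proof.
apply: (crd_inj be) => k; rewrite !(crdD, crdZ) crd_contr // /contr_crd.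
rewrite crd_cross // !crd_contr // /gram !dotE !crd_cross // /cross_crd /contr_crd /= /det2.
by case: k => [[|[|[|[|[|[|[|]]]]]]]] //= _; ring.
Qed.

Lemma dot_framel k x : (k < 7)%N -> dot b`_k x = crd e k x.
Proof.
move=> k7; rewrite /dot (bigD1 (Ordinal k7)) //= crd_frame // eqxx mul1r.
rewrite big1 ?addr0 // => i ik; rewrite crd_frame //.
by rewrite (negbTE (_ : (i : nat) != k)) ?mul0r.
Qed.

Lemma dotC x y : dot x y = dot y x.
Proof. by apply: eq_bigr => i _; rewrite mulrC. Qed.

(** By skewness this is minus the trace of the square of [contr p q], which is -[gram p q] on a
    4-dimensional complement and 0 on p, q, p x q. *)
Lemma trace_contr_sqr p q :
  \sum_(i < 7) dot (contr p q b`_i) (contr p q b`_i) = 4%:R * gram p q.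
Proof.
have E (i : 'I_7) : dot (contr p q b`_i) (contr p q b`_i) = gram p q
    - (dot q q * crd e i p ^+ 2 - 2%:R * dot p q * crd e i p * crd e i q
       + dot p p * crd e i q ^+ 2) - crd e i (cross p q) ^+ 2.
  rewrite contr_skew contr_sqr dot_framel // !(crdD, crdZ) crd_frame // eqxx.
  rewrite ![dot _ b`_i]dotC !dot_framel //=; ring.
under eq_bigr => i _ do rewrite E.
transitivity (7%:R * gram p q - 2%:R * gram p q - dot (cross p q) (cross p q)).
  by rewrite /gram !dotE !(big_ord_recr, big_ord0) /=; ring.
by rewrite dot_cross; ring.
Qed.

Lemma psi4_linear1 y z w : scalar (fun x => psi4 e x y z w).
Proof. by move=> a x x'; rewrite /psi4 /det4 !(crdD, crdZ); ring. Qed.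

Lemma psi4_diag x z w : psi4 e x x z w = 0.
Proof. by rewrite /psi4 /det4 /det3 /det2; ring. Qed.

(** In d psi(p,x,y,z,w) only brackets of the last four arguments survive, p being central, and their
    p-components drop out because psi already contains p. What remains is the wedge product of
    h([.,.]) with psi(q,p,.,.). *)
Lemma closed_contr br (h : {scalar V}) p q x y z w :
  (forall v x y z w, d4 br (psi4 e) v x y z w = 0) ->
  (forall x, br p x = 0) -> (forall x y, exists s, br x y = s *: p + h (br x y) *: q) ->
  h (br x y) * dot (contr p q z) w - h (br x z) * dot (contr p q y) w
  + h (br x w) * dot (contr p q y) z + h (br y z) * dot (contr p q x) w
  - h (br y w) * dot (contr p q x) z + h (br z w) * dot (contr p q x) y = 0.
Proof.
move=> closed p0 brE; have := closed p x y z w; rewrite /d4 !p0.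
have E u v m n : psi4 e (br u v) p m n = h (br u v) * dot (contr p q m) n.
  have [s sE] := brE u v; rewrite {1}sE psi4_linear1 psi4_diag mulr0 add0r.
  by have := psi4_linear1 p m n (h (br u v)) q 0; rewrite addr0 => ->;
    rewrite psi4_contr /psi4 /det4 !crd0; ring.
have Z m n k : psi4 e 0 m n k = 0 by rewrite /psi4 /det4 !crd0; ring.
by rewrite !E !Z => H; rewrite -[RHS]oppr0 -[in RHS]H; ring.
Qed.

(** Contracting theta /\ A = 0 with A in two arguments leaves (4 - 1 - 1) |p /\ q|^2 theta(x) = 0:
    the 4 is the trace of -A^2, and each of the other two terms gives -1. *)
Lemma closed_cross br (h : {scalar V}) p q x :
  (forall v x y z w, d4 br (psi4 e) v x y z w = 0) -> (forall x, br x x = 0) ->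
  (forall x, br p x = 0) -> (forall x, br q x = 0) ->
  (forall x y, exists s, br x y = s *: p + h (br x y) *: q) -> gram p q != 0 ->
  h (br x (cross p q)) = 0.
Proof.
move=> closed brxx p0 q0 brE g0; set u := cross p q.
pose th y := h (br y u).
have thD a y z : th (a *: y + z) = a * th y + th z.
  by rewrite /th linearPl linearP.
pose thL := GRing.isLinear.Build _ _ _ _ (th : V -> R^o) thD.
pose T : {linear V -> R^o} := HB.pack (th : V -> R^o) thL.
have thS (c : 'I_7 -> R) : \sum_i c i * th b`_i = th (\sum_i c i *: b`_i).
  rewrite -[th (\sum_i _)]/(T _) linear_sum; apply: eq_bigr => i _.
  by rewrite linearZ.
(* With u as last argument of [closed_contr], the terms pairing [contr] with u vanish. *)
have key y z : th x * dot (contr p q y) z - th y * dot (contr p q x) z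
    + th z * dot (contr p q x) y = 0.
  have := closed_contr x y z u closed p0 brE.
  have E w : dot (contr p q w) u = 0.
    by rewrite contr_skew contr_cross dotE !crd0; ring.
  rewrite !E => H; rewrite -[RHS]H /th; ring.
pose S := \sum_(k < 7) th b`_k * dot (contr p q x) (contr p q b`_k).
(* S is -theta(A^2 x), and theta vanishes on p and q, which are central, and on u; only the multiple
   of x in [contr_sqr] counts. *)
have thCC : S = gram p q * th x.
  have -> : S = - \sum_(k < 7) crd e k (contr p q (contr p q x)) * th b`_k.
    rewrite -sumrN; apply: eq_bigr => k _; rewrite -[dot _ _]opprK -contr_skew.
    by rewrite dotC dot_framel // mulrN mulrC.
  have thA y z : th (y + z) = th y + th z by rewrite -[y]scale1r thD mul1r scale1r.
  have th0 : th 0 = 0 by rewrite -[th 0]/(T 0) linear0.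
  have thZ a y : th (a *: y) = a * th y by rewrite -[a *: y]addr0 thD th0 addr0.
  rewrite thS -be.2 contr_sqr !thA !thZ.
  rewrite {2}/th p0 {2}/th q0 {2}/th brxx linear0; ring.
have second : \sum_(i < 7) th (contr p q b`_i) * dot (contr p q x) b`_i = - S.
  have thC i : th (contr p q b`_i) =
      - \sum_(k < 7) dot b`_i (contr p q b`_k) * th b`_k.
    rewrite {1}[contr p q b`_i]be.2 -thS -sumrN; apply: eq_bigr => k _.
    by rewrite -[crd e k _]dot_framel // dotC contr_skew mulNr.
  under eq_bigr => i _ do rewrite thC mulNr mulr_suml.
  rewrite sumrN exchange_big /=; congr (- _); apply: eq_bigr => k _.
  rewrite [X in _ * X]/dot mulr_sumr; apply: eq_bigr => i _.
  by rewrite dot_framel // [dot _ b`_i]dotC dot_framel //; ring.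
(* This is [key] at y = b_i and z = [contr p q] b_i, summed over the frame. *)
have total : \sum_(i < 7) (th x * dot (contr p q b`_i) (contr p q b`_i)
    - th b`_i * dot (contr p q x) (contr p q b`_i)
    + th (contr p q b`_i) * dot (contr p q x) b`_i) = 0.
  by apply: big1 => i _; apply: key.
move: total; rewrite big_split sumrB /= -mulr_sumr trace_contr_sqr second -/S thCC => H.
have : 2%:R * gram p q * th x = 0 by rewrite -[RHS]H; ring.
by move/eqP; rewrite !mulf_eq0 pnatr_eq0 (negbTE g0) /= => /eqP.
Qed.
End Obstruction.

(** * Ricci curvature *)

Section LeviCivita.
Context {R : realType} {V : vectType R}.

Lemma hom_of_bilinear (N : V -> V -> V) :
  (forall x, linear (N x)) -> (forall y, linear (N^~ y)) ->
  exists nabla : 'Hom(V, 'End(V)), forall x y, nabla x y = N x y.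
Proof.
move=> lr ll.
pose F x : {linear V -> V} := HB.pack (N x) (GRing.isLinear.Build _ _ _ _ (N x) (lr x)).
have Flin : linear (fun x => linfun (F x)).
  by move=> a x y; apply/lfunP=> z; rewrite add_lfunE scale_lfunE !lfunE /= ll.
pose G : {linear V -> 'End(V)} :=
  HB.pack (fun x => linfun (F x)) (GRing.isLinear.Build _ _ _ _ _ Flin).
by exists (linfun G) => x y; rewrite !lfunE.
Qed.

Variables (br : {bilinear V -> V -> V}).
Variables (e : 7.-tuple 'Hom(V, R^o)) (b : 7.-tuple V).
Hypothesis be : dual_frames b e.
Hypothesis brC : forall x y, br x y = - br y x.

Lemma dotP x y z a : dot e (a *: x + y) z = a * dot e x z + dot e y z.
Proof.
rewrite /dot mulr_sumr -big_split; apply: eq_bigr => i _ /=.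
by rewrite crdD crdZ mulrDl mulrA.
Qed.

Lemma dotPr x y z a : dot e z (a *: x + y) = a * dot e z x + dot e z y.
Proof.
rewrite /dot mulr_sumr -big_split; apply: eq_bigr => i _ /=.
by rewrite crdD crdZ; ring.
Qed.

(** [ricci_tensor] takes its trace in [vbasis]; basis independence moves it to the frame. *)
Lemma trace_frame (F : 'End(V)) :
  \sum_(i < \dim {:V}) coord (vbasis {:V}) i (F (tnth (vbasis {:V}) i)) =
  \sum_(i < 7) crd e i (F b`_i).
Proof.
have bE (i : 'I_7) : b`_i = \sum_j coord (vbasis {:V}) j b`_i *: (vbasis {:V})`_j.
  by rewrite -(coord_basis (vbasisP _)) ?memvf.
under [RHS]eq_bigr => i _ do rewrite bE linear_sum crd_sum.
rewrite exchange_big /=; apply: eq_bigr => j _; rewrite (tnth_nth 0).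
rewrite {1}[F _]be.2 linear_sum; apply: eq_bigr => i _.
by rewrite !linearZ /= crdZ mulrC.
Qed.

(** The connection given by Koszul's formula for left-invariant fields, 2 g(nabla_x y, z) =
    g([x,y],z) + g([z,x],y) + g([z,y],x), read off at z = b_k. *)
Definition koszul x y := 2%:R^-1 *:
  (br x y + \sum_(k < 7) (dot e (br b`_k x) y + dot e (br b`_k y) x) *: b`_k).

Lemma crd_koszul k x y : (k < 7)%N -> crd e k (koszul x y) =
  (crd e k (br x y) + dot e (br b`_k x) y + dot e (br b`_k y) x) / 2%:R.
Proof.
move=> k7; rewrite /koszul crdZ crdD crd_sum (bigD1 (Ordinal k7)) //=.
rewrite crdZ crd_frame // eqxx mulr1 big1 ?addr0 => [|i ik]; first by rewrite mulrC addrA.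
by rewrite crdZ crd_frame // eq_sym (negbTE (_ : (i : nat) != k)) ?mulr0.
Qed.

Lemma dot_bracket_frame x y z :
  \sum_(k < 7) dot e (br b`_k x) y * crd e k z = dot e (br z x) y.
Proof.
rewrite {2}[z]be.2 linear_sumlz /dot.
under [RHS]eq_bigr => j _ do rewrite crd_sum mulr_suml.
rewrite [RHS]exchange_big; apply: eq_bigr => i _; rewrite mulr_suml.
by apply: eq_bigr => j _; rewrite linearZl_LR crdZ; ring.
Qed.

Lemma koszul_levi_civita : exists2 nabla, is_levi_civita br (dot e) nabla &
  forall x y, nabla x y = koszul x y.
Proof.
have [||nabla nE] := hom_of_bilinear (N := koszul).
- move=> x a y z; apply: (crd_inj be) => k; rewrite crdD crdZ !crd_koszul //.
  by rewrite !linearPr !dotPr !dotP crdD crdZ /=; ring.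
- move=> y a x z; apply: (crd_inj be) => k; rewrite crdD crdZ !crd_koszul //.
  by rewrite linearPr linearPl !dotPr !dotP crdD crdZ /=; ring.
exists nabla => //; split=> [x y|x y z]; rewrite !nE.
  apply: (crd_inj be) => k; rewrite crdD crdN !crd_koszul // (brC y x) crdN.
  by field.
(* Koszul's formula against an arbitrary vector; adding it with the last two arguments exchanged
   gives metric compatibility. *)
have E u v w : dot e (koszul u v) w =
    (dot e (br u v) w + dot e (br w u) v + dot e (br w v) u) / 2%:R.
  rewrite -(dot_bracket_frame u v w) -(dot_bracket_frame v u w).
  rewrite [dot e (koszul u v) w]/dot [dot e (br u v) w]/dot -!big_split mulr_suml.
  by apply: eq_bigr => k _ /=; rewrite crd_koszul //; field.
rewrite [dot e y _]dotC !E (brC z x) (brC z y) (brC y x).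
have N u v : dot e (- u) v = - dot e u v.
  by rewrite /dot -sumrN; apply: eq_bigr => i _; rewrite crdN mulNr.
by rewrite !N; field.
Qed.

Lemma ricci_frame nabla y z :
  ricci_tensor br nabla y z = \sum_(i < 7) crd e i (nabla b`_i (nabla y z)
     - nabla y (nabla b`_i z) - nabla (br b`_i y) z).
Proof.
have Flin : linear (fun x => curvature br nabla x y z).
  move=> a x x'; rewrite /curvature !(add_lfunE, opp_lfunE, comp_lfunE) /=.
  rewrite linearPl !linearP /= !(add_lfunE, scale_lfunE, linearP) /=.
  by rewrite !scalerDr !scalerN [X in X + _ = _]addrACA [LHS]addrACA.
pose F : {linear V -> V} :=
  HB.pack (fun x : V => curvature br nabla x y z) (GRing.isLinear.Build _ _ _ _ _ Flin).
transitivity (\sum_(i < 7) crd e i (linfun F b`_i)).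
  by rewrite -trace_frame; apply: eq_bigr => i _; rewrite [linfun F _]lfunE.
apply: eq_bigr => i _; rewrite [linfun F _]lfunE /= /curvature.
by rewrite !(add_lfunE, opp_lfunE, comp_lfunE).
Qed.

End LeviCivita.

(** * Frames with diagonal Ricci endomorphism *)

Section Models.
Context {R : realType} {V : vectType R}.
Variables (br : {bilinear V -> V -> V}).
Hypothesis dV : \dim {:V} = 7%N.
Hypothesis brxx : forall x, br x x = 0.

Lemma br_skew x y : br x y = - br y x.
Proof.
apply/eqP; rewrite -addr_eq0; have := brxx (x + y).
by rewrite linearDl !linearDr /= !brxx add0r addr0 => ->.
Qed.

Definition diag_frame (e : 7.-tuple 'Hom(V, R^o)) (b : 7.-tuple V) (r : seq R) x :=
  \sum_(k < 7) (r`_k * crd e k x) *: b`_k.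

Lemma crd_diag_frame e b r k x : dual_frames b e -> (k < 7)%N ->
  crd e k (diag_frame e b r x) = r`_k * crd e k x.
Proof.
move=> be k7; rewrite crd_sum (bigD1 (Ordinal k7)) //= crdZ crd_frame // eqxx mulr1.
rewrite big1 ?addr0 // => i ik.
by rewrite crdZ crd_frame // eq_sym (negbTE (_ : (i : nat) != k)) ?mulr0.
Qed.

(** The derivation is D = Ric - lambda I with Ric = diag(r); the last hypothesis is the Leibniz rule
    for D, coordinate by coordinate. *)
Lemma diag_nilsoliton e b (r : seq R) (lambda : R) : dual_frames b e ->
  (forall y z, \sum_(i < 7) crd e i (koszul br e b b`_i (koszul br e b y z)
     - koszul br e b y (koszul br e b b`_i z) - koszul br e b (br b`_i y) z) =
     dot e (diag_frame e b r y) z) ->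
  (forall (k : 'I_7) x y, (r`_k - lambda) * crd e k (br x y) =
     crd e k (br (diag_frame e b r x) y) + crd e k (br x (diag_frame e b r y))
     - 2%:R * lambda * crd e k (br x y)) ->
  is_nilsoliton br (dot e).
Proof.
move=> be ricE derE; split.
  split=> [u a x y|u v|u u0]; [exact: dotPr | exact: dotC |].
  rewrite lt_def; apply/andP; split; first by apply: contra_neq u0 => /(dot_eq0 be).
  by apply: sumr_ge0 => i _; apply: sqr_ge0.
have Dlin : linear (diag_frame e b r).
  by move=> a x y; apply: (crd_inj be) => k;
    rewrite crdD crdZ !crd_diag_frame // crdD crdZ; ring.
pose F : {linear V -> V} :=
  HB.pack (diag_frame e b r) (GRing.isLinear.Build _ _ _ _ _ Dlin).
exists (linfun F), lambda, (linfun F - lambda *: \1%VF); split; last by rewrite addrC subrK.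
  have [nabla lc nE] := koszul_levi_civita be br_skew.
  exists nabla => // y z; rewrite (ricci_frame br be) [linfun F _]lfunE -ricE.
  by apply: eq_bigr => i _; rewrite !nE.
move=> x y; rewrite !(add_lfunE, opp_lfunE, scale_lfunE, id_lfunE) ![linfun F _]lfunE.
apply: (crd_inj be) => k.
rewrite !(linearBl, linearBr) /= linearZl_LR linearZr_LR /=.
rewrite !(crdD, crdN, crdZ) crd_diag_frame //.
by have := derE k x y; rewrite mulrBl => ->; ring.
Qed.

Lemma coclosed_nilsoliton_of_frame (e : 7.-tuple _) (b : 7.-tuple V) (r : seq R) lambda :
  basis_of fullv e -> dual_frames b e ->
  (forall v x y z w, d4 br (psi4 e) v x y z w = 0) ->
  (forall y z, \sum_(i < 7) crd e i (koszul br e b b`_i (koszul br e b y z)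
     - koszul br e b y (koszul br e b b`_i z) - koszul br e b (br b`_i y) z) =
     dot e (diag_frame e b r y) z) ->
  (forall (k : 'I_7) x y, (r`_k - lambda) * crd e k (br x y) =
     crd e k (br (diag_frame e b r x) y) + crd e k (br x (diag_frame e b r y))
     - 2%:R * lambda * crd e k (br x y)) ->
  exists phi : cochain V 3,
    [/\ is_G2_structure phi, is_coclosed br phi & induces_nilsoliton br phi].
Proof.
move=> eb be closed ricE derE; exists (g2_model e).
have ad : is_adapted_coframe (g2_model e) e by split.
split; first by split; [exact: g2_model_is_form | exists e].
  exact: frame_coclosed be closed.
exists (dot e), (ewedge e [:: 1; 2; 3; 4; 5; 6; 7]%N); split.
  exists e; split=> // u v; rewrite /dot; apply: eq_bigr => i _.
  by rewrite !(tnth_nth 0).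
exact: diag_nilsoliton be ricE derE.
Qed.

Lemma crd_br_frame (e : 7.-tuple _) (b : 7.-tuple V) x y k : dual_frames b e ->
  crd e k (br x y) = \sum_(i < 7) \sum_(j < 7) crd e i x * crd e j y * crd e k (br b`_i b`_j).
Proof.
move=> [_ bE]; rewrite {1}[x]bE linear_sumlz crd_sum; apply: eq_bigr => i _.
rewrite linearZl_LR {1}[y]bE linear_sumr /= crdZ crd_sum mulr_sumr.
by apply: eq_bigr => j _; rewrite linearZr_LR crdZ mulrA.
Qed.

End Models.

(** * The normal forms *)

Section SevenThree.
Context {R : realType} {V : vectType R}.
Variables (br : {bilinear V -> V -> V}).
Hypothesis dV : \dim {:V} = 7%N.
Hypothesis brxx : forall x, br x x = 0.
Variables (b : 7.-tuple V) (e : 7.-tuple 'Hom(V, R^o)) (m2 m3 m4 : R).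
Hypothesis be : dual_frames b e.
Hypothesis eb : basis_of fullv e.
Hypothesis central : forall x, [/\ br b`_4 x = 0, br b`_5 x = 0 & br b`_6 x = 0].
Hypothesis br0 : [/\ br b`_0 b`_1 = b`_6, br b`_0 b`_2 = b`_4 & br b`_0 b`_3 = b`_5].
Hypothesis br1 : [/\ br b`_2 b`_3 = m2 *: b`_6, br b`_3 b`_1 = m3 *: b`_4 &
                     br b`_1 b`_2 = m4 *: b`_5].
Hypothesis m_sign : [/\ m2 ^+ 3 = m2, m3 ^+ 3 = m3 & m4 ^+ 3 = m4].

Notation X := (crd e).

(* The frame is (f1, f2, f3, f4, z3, z4, z2), so that e^5, e^6, e^7 span the dual of the
   centre and the self-dual parts of de^5, de^6, de^7 are diagonal in the self-dual basis
   e^13 - e^24, e^14 + e^23, e^12 + e^34; this diagonality makes psi closed. *)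
Definition bracket43 x y : seq R := [:: 0; 0; 0; 0;
  X 0 x * X 2 y - X 2 x * X 0 y + m3 * (X 3 x * X 1 y - X 1 x * X 3 y);
  X 0 x * X 3 y - X 3 x * X 0 y + m4 * (X 1 x * X 2 y - X 2 x * X 1 y);
  X 0 x * X 1 y - X 1 x * X 0 y + m2 * (X 2 x * X 3 y - X 3 x * X 2 y)].

Lemma crd_bracket43 k x y : (k < 7)%N -> X k (br x y) = (bracket43 x y)`_k.
Proof.
move=> k7; rewrite (crd_br_frame _ _ _ _ be) !(big_ord_recr, big_ord0) /=.
have skew := br_skew brxx.
have [c4 c5 c6] : [/\ forall x, br b`_4 x = 0, forall x, br b`_5 x = 0 & forall x, br b`_6 x = 0].
  by split=> u; case: (central u).
have [d4 d5 d6] : [/\ forall x, br x b`_4 = 0, forall x, br x b`_5 = 0 & forall x, br x b`_6 = 0].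
  by split=> u; rewrite skew ?c4 ?c5 ?c6 oppr0.
have [b01 b02 b03] := br0; have [b23 b31 b12] := br1.
rewrite !c4 !c5 !c6 !d4 !d5 !d6 !brxx.
rewrite (skew b`_1 b`_0) (skew b`_2 b`_0) (skew b`_3 b`_0).
rewrite (skew b`_3 b`_2) (skew b`_1 b`_3) (skew b`_2 b`_1).
rewrite b01 b02 b03 b23 b31 b12 !crdN !crdZ !(crd_frame be) // !crd0 /bracket43.
by move: k k7; do 7?[case=> //=]; move=> *; ring.
Qed.

Definition koszul43 x y : seq R := [seq t / 2%:R | t <- [::
  X 2 x * X 4 y + X 3 x * X 5 y + X 1 x * X 6 y + X 2 y * X 4 x + X 3 y * X 5 x + X 1 y * X 6 x;
  - m3 * X 3 x * X 4 y + m4 * X 2 x * X 5 y - X 0 x * X 6 y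
    - m3 * X 3 y * X 4 x + m4 * X 2 y * X 5 x - X 0 y * X 6 x;
  - X 0 x * X 4 y - m4 * X 1 x * X 5 y + m2 * X 3 x * X 6 y
    - X 0 y * X 4 x - m4 * X 1 y * X 5 x + m2 * X 3 y * X 6 x;
  m3 * X 1 x * X 4 y - X 0 x * X 5 y - m2 * X 2 x * X 6 y
    + m3 * X 1 y * X 4 x - X 0 y * X 5 x - m2 * X 2 y * X 6 x;
  (bracket43 x y)`_4; (bracket43 x y)`_5; (bracket43 x y)`_6]].

Lemma crd_koszul43 k x y : (k < 7)%N -> X k (koszul br e b x y) = (koszul43 x y)`_k.
Proof.
move=> k7; rewrite crd_koszul // !dotE !crd_bracket43 // /koszul43 /bracket43.
rewrite (nth_map 0) //=; congr (_ / _); rewrite !(crd_frame be) //.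
by move: k k7; do 7?[case=> //=]; move=> *; ring.
Qed.

(** Ricci eigenvalues: minus half the squared norm of ad on the first four vectors, and half the sum
    of the squared coefficients of de^k on the central ones. *)
Definition ricci43 : seq R := [seq t / 2%:R | t <- [:: - 3%:R; - (1 + m3 ^+ 2 + m4 ^+ 2);
  - (1 + m2 ^+ 2 + m4 ^+ 2); - (1 + m2 ^+ 2 + m3 ^+ 2);
  1 + m3 ^+ 2; 1 + m4 ^+ 2; 1 + m2 ^+ 2]].

Lemma closed43 v x y z w : d4 br (psi4 e) v x y z w = 0.
Proof.
(* Each monomial of a central component of the bracket shares an index with every monomial of the
   two self-dual forms multiplying it, so all wedge products vanish. *)
have E s t p q r : psi4 e (br s t) p q r =
    (bracket43 s t)`_4 * (det3 e 0 1 5 p q r + det3 e 0 3 6 p q r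
                          + det3 e 1 2 6 p q r + det3 e 2 3 5 p q r)
    + (bracket43 s t)`_5 * (det3 e 0 2 6 p q r - det3 e 0 1 4 p q r
                            - det3 e 1 3 6 p q r - det3 e 2 3 4 p q r)
    + (bracket43 s t)`_6 * (det3 e 1 3 5 p q r - det3 e 0 2 5 p q r
                            - det3 e 0 3 4 p q r - det3 e 1 2 4 p q r).
  by rewrite /psi4 /det4 !crd_bracket43 //=; ring.
rewrite /d4 !E /det3 /det2 /=; ring.
Qed.

Lemma ricci43E y z : \sum_(i < 7) X i (koszul br e b b`_i (koszul br e b y z)
     - koszul br e b y (koszul br e b b`_i z) - koszul br e b (br b`_i y) z) =
     dot e (diag_frame e b ricci43 y) z.
Proof.
rewrite !(big_ord_recr, big_ord0) /= dotE !crd_diag_frame //.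
rewrite !(crdD, crdN) !crd_koszul43 // /koszul43 /bracket43 /=.
rewrite !crd_koszul43 // /koszul43 /bracket43 /=.
rewrite !crd_bracket43 // /bracket43 /=.
rewrite !(crd_frame be) //=.
by field.
Qed.

Lemma coclosed_nilsoliton43 : exists phi : cochain V 3,
    [/\ is_G2_structure phi, is_coclosed br phi & induces_nilsoliton br phi].
Proof.
(* A nonzero coefficient of b_k in [b_i,b_j] forces lambda = r_i + r_j - r_k. The brackets with f1
   give this value; the others agree with it when their coefficient squares to 1. *)
apply: (@coclosed_nilsoliton_of_frame _ _ br dV brxx e b ricci43
  (- (5%:R + m2 ^+ 2 + m3 ^+ 2 + m4 ^+ 2) / 2%:R)) => //.
- exact: closed43.
- exact: ricci43E.
move=> k x y; rewrite !crd_bracket43 // /bracket43 !crd_diag_frame //.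
have sgn (m : R) : m ^+ 3 = m -> [\/ m = 0, m = 1 | m = -1].
  move=> mE; have : m * (m - 1) * (m + 1) = m ^+ 3 - m by ring.
  rewrite mE subrr => /eqP; rewrite !mulf_eq0 subr_eq0 addr_eq0 -orbA.
  by case/or3P=> /eqP ->; [constructor 1|constructor 2|constructor 3].
case: m_sign => /sgn s2 /sgn s3 /sgn s4.
case: k => [[|[|[|[|[|[|[|]]]]]]]] //= _; try ring.
- by case: s3 => ->; field.
- by case: s4 => ->; field.
- by case: s2 => ->; field.
Qed.

End SevenThree.

Section Heisenberg.
Context {R : realType} {V : vectType R}.
Variables (br : {bilinear V -> V -> V}).
Hypothesis dV : \dim {:V} = 7%N.
Hypothesis brxx : forall x, br x x = 0.
Variables (b : 7.-tuple V) (e : 7.-tuple 'Hom(V, R^o)).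
Hypothesis be : dual_frames b e.
Hypothesis eb : basis_of fullv e.

Notation X := (crd e).

Definition symplectic61 x y : R := X 0 x * X 1 y - X 1 x * X 0 y
  + (X 2 x * X 3 y - X 3 x * X 2 y) + (X 4 x * X 5 y - X 5 x * X 4 y).

Hypothesis brE : forall x y, br x y = symplectic61 x y *: b`_6.

Lemma crd_bracket61 k x y : (k < 7)%N ->
  X k (br x y) = symplectic61 x y * (k == 6)%:R.
Proof. by move=> k7; rewrite brE crdZ crd_frame. Qed.

Definition koszul61 x y : seq R := [seq t / 2%:R | t <- [::
  X 1 x * X 6 y + X 1 y * X 6 x; - X 0 x * X 6 y - X 0 y * X 6 x;
  X 3 x * X 6 y + X 3 y * X 6 x; - X 2 x * X 6 y - X 2 y * X 6 x;
  X 5 x * X 6 y + X 5 y * X 6 x; - X 4 x * X 6 y - X 4 y * X 6 x;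
  symplectic61 x y]].

Lemma crd_koszul61 k x y : (k < 7)%N -> X k (koszul br e b x y) = (koszul61 x y)`_k.
Proof.
move=> k7; rewrite crd_koszul // !dotE !crd_bracket61 // /koszul61.
rewrite (nth_map 0) //=; congr (_ / _); rewrite /symplectic61 !(crd_frame be) //.
by move: k k7; do 7?[case=> //=]; move=> *; ring.
Qed.

Definition ricci61 : seq R := [seq t / 2%:R | t <- [:: -1; -1; -1; -1; -1; -1; 3%:R]].

(** Contracting psi with b_7 gives minus the imaginary part of (e^1 + i e^2)(e^3 + i e^4)(e^5 + i
    e^6), whose wedge product with e^12 + e^34 + e^56 vanishes by type. *)
Lemma closed61 v x y z w : d4 br (psi4 e) v x y z w = 0.
Proof.
have E s t p q r : psi4 e (br s t) p q r =
    symplectic61 s t * (det3 e 1 3 5 p q r - det3 e 0 2 5 p q r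
                        - det3 e 0 3 4 p q r - det3 e 1 2 4 p q r).
  by rewrite /psi4 /det4 !crd_bracket61 //=; ring.
rewrite /d4 !E /symplectic61 /det3 /det2 /=; ring.
Qed.

Lemma ricci61E y z : \sum_(i < 7) X i (koszul br e b b`_i (koszul br e b y z)
     - koszul br e b y (koszul br e b b`_i z) - koszul br e b (br b`_i y) z) =
     dot e (diag_frame e b ricci61 y) z.
Proof.
rewrite !(big_ord_recr, big_ord0) /= dotE !crd_diag_frame //.
rewrite !(crdD, crdN) !crd_koszul61 // /koszul61 /symplectic61 /=.
rewrite !crd_koszul61 // /koszul61 /symplectic61 /=.
rewrite !crd_bracket61 // /symplectic61 /=.
rewrite !(crd_frame be) //=.
by field.
Qed.

Lemma coclosed_nilsoliton61 : exists phi : cochain V 3,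
    [/\ is_G2_structure phi, is_coclosed br phi & induces_nilsoliton br phi].
Proof.
(* Here lambda = r_i + r_j - r_7 = -1/2 - 1/2 - 3/2. *)
apply: (@coclosed_nilsoliton_of_frame _ _ br dV brxx e b ricci61 (- 5%:R / 2%:R)) => //.
- exact: closed61.
- exact: ricci61E.
move=> k x y; rewrite !crd_bracket61 // /symplectic61 !crd_diag_frame //.
by case: k => [[|[|[|[|[|[|[|]]]]]]]] //= _; field.
Qed.

End Heisenberg.

(** * Reduction to the normal forms *)

Section LinearAlgebra.
Context {R : realType} {V : vectType R}.
Implicit Types (W : {vspace V}).

Lemma dim_cap_lker W (f : 'Hom(V, R^o)) : (\dim W <= (\dim (W :&: lker f)).+1)%N.
Proof.
rewrite -(limg_ker_dim f W) -addn1 leq_add2l.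
by apply: leq_trans (dimvS (subvf _)) _; rewrite dimvf.
Qed.

Lemma hom_of_scalar (h : V -> R) : scalar h ->
  exists f : 'Hom(V, R^o), forall x, f x = h x.
Proof.
move=> hl; pose F : {linear V -> R^o} :=
  HB.pack (h : V -> R^o) (GRing.isLinear.Build _ _ _ _ (h : V -> R^o) hl).
by exists (linfun F) => x; rewrite lfunE.
Qed.

Lemma vspace_extend W (X : seq V) : (size X < \dim W)%N ->
  exists2 x, x \in W & x \notin <<X>>%VS.
Proof.
move=> XW; have /subvPn[x xW xX] : ~~ (W <= <<X>>)%VS; last by exists x.
by apply: contraL XW => /dimvS WX; rewrite -leqNgt (leq_trans WX) // dim_span.
Qed.

Lemma span_of_free W (X : seq V) : (<<X>> <= W)%VS -> free X -> size X = \dim W -> <<X>>%VS = W.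
Proof. by move=> XW /eqnP dX sX; apply/eqP; rewrite eqEdim XW dX sX leqnn. Qed.

Lemma free_of_span W (X : seq V) : (W <= <<X>>)%VS -> size X = \dim W -> free X.
Proof.
move=> WX sX; rewrite /free eqn_leq dim_span sX.
exact: dimvS.
Qed.

Variable w : V -> V -> R.
Hypothesis wl : forall x, scalar (w^~ x).
Hypothesis wr : forall x, scalar (w x).

Let wD x y z : w x (y + z) = w x y + w x z.
Proof. by rewrite -[y]scale1r wr mul1r scale1r. Qed.
Let w0 x : w x 0 = 0.
Proof. by have := wr x (-1) 0 0; rewrite scaler0 addr0 mulN1r addNr. Qed.
Let wZ x a y : w x (a *: y) = a * w x y.
Proof. by rewrite -[a *: y]addr0 wr w0 addr0. Qed.
Let wDl x y z : w (x + y) z = w x z + w y z.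
Proof. by rewrite -[x]scale1r wl mul1r scale1r. Qed.
Let w0l x : w 0 x = 0.
Proof. by have := wl x (-1) 0 0; rewrite scaler0 addr0 mulN1r addNr. Qed.
Let wZl x a y : w (a *: x) y = a * w x y.
Proof. by rewrite -[a *: x]addr0 wl w0l addr0. Qed.

Definition nondegenerate_on W :=
  forall x, x \in W -> (forall y, y \in W -> w x y = 0) -> x = 0.

(** Splits off a hyperbolic plane; W' is its orthogonal in W. *)
Lemma darboux_step W : (forall x, w x x = 0) -> nondegenerate_on W -> W != 0%VS ->
  exists x y W', [/\ [/\ x \in W, y \in W & w x y = 1],
    (W' <= W)%VS, (\dim W <= (\dim W').+2)%N, nondegenerate_on W' &
    forall z, z \in W' -> w x z = 0 /\ w y z = 0].
Proof.
move=> wxx nd W0.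
have wC x y : w x y = - w y x.
  by apply/eqP; rewrite -addr_eq0; have := wxx (x + y);
    rewrite wDl !wD !wxx add0r addr0 => ->.
pose x := vpick W; have xW : x \in W by exact: memv_pick.
have x0 : x != 0 by rewrite vpick0.
have [y0 y0W xy0] : exists2 y, y \in W & w x y != 0.
  apply: contrapT => no; case/eqP: x0; apply: nd => // y yW.
  by apply/eqP; apply: contrapT => /negP xy; apply: no; exists y.
have [y yW xy] : exists2 y, y \in W & w x y = 1.
  by exists ((w x y0)^-1 *: y0); rewrite ?memvZ // wZ mulVf.
have [f fE] := hom_of_scalar (wr x); have [g gE] := hom_of_scalar (wr y).
exists x, y, (W :&: lker f :&: lker g)%VS; split=> //.
- by rewrite -capvA capvSl.
- apply: leq_trans (dim_cap_lker W f) _.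
  by rewrite ltnS; apply: dim_cap_lker.
- move=> z; rewrite !memv_cap !memv_ker fE gE => /andP[/andP[zW /eqP xz] /eqP yz] nz.
  apply: nd => // t tW.
  (* The projection of t to W'; since z is orthogonal to x and y, it pairs with z as t does. *)
  have tE : t - w x t *: y + w y t *: x \in (W :&: lker f :&: lker g)%VS.
    rewrite !memv_cap !memv_ker fE gE rpredD ?rpredB ?memvZ //=.
    rewrite !wD -![- (_ *: _)]scaleNr !wZ !wxx (wC y x) xy.
    by apply/andP; split; apply/eqP; ring.
  have := nz _ tE; rewrite !wD -[- (_ *: _)]scaleNr !wZ (wC z x) (wC z y) xz yz.
  by rewrite oppr0 !mulr0 !addr0.
- by move=> z; rewrite !memv_cap !memv_ker fE gE => /andP[/andP[_ /eqP ->] /eqP ->].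
Qed.

(** A non-isotropic vector is scaled to w(x,x) = 1 or -1 and W' is its orthogonal. If there is none,
    w vanishes on W by polarisation and any complement of a line will do. The cubic equation encodes
    the values 0, 1, -1. *)
Lemma orthogonal_step W : (forall x y, w x y = w y x) -> W != 0%VS ->
  exists x W', [/\ [/\ x \in W, x \notin W' & w x x ^+ 3 = w x x],
    (W' <= W)%VS, (\dim W <= (\dim W').+1)%N & forall z, z \in W' -> w x z = 0].
Proof.
move=> wC W0; have [[x xW xx]|no] := pselect (exists2 x, x \in W & w x x != 0).
  pose c := (Num.sqrt `|w x x|)^-1; pose y := c *: x.
  have yy : w y y ^+ 2 = 1.
    rewrite wZ wZl mulrA -expr2 exprMn -exprM /c exprVn.
    by rewrite exprM sqr_sqrtr // real_normK ?num_real // mulVf // sqrf_eq0.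
  have yy0 : w y y != 0 by rewrite -sqrf_eq0 yy oner_eq0.
  have [f fE] := hom_of_scalar (wr y).
  exists y, (W :&: lker f)%VS; split; rewrite ?capvSl ?dim_cap_lker //.
    split; first by rewrite memvZ.
      by rewrite memv_cap memv_ker fE (negbTE yy0) andbF.
    by rewrite exprS yy mulr1.
  by move=> z; rewrite memv_cap memv_ker fE => /andP[_ /eqP].
have wxx x : x \in W -> w x x = 0.
  by move=> xW; apply/eqP; apply: contrapT => /negP xx; apply: no; exists x.
have wW x y : x \in W -> y \in W -> w x y = 0.
  move=> xW yW; have := wxx _ (rpredD xW yW).
  rewrite wDl !wD !wxx // add0r addr0 (wC y x) -mulr2n => /eqP.
  by rewrite mulrn_eq0 /= => /eqP.
pose x := vpick W; have xW : x \in W by exact: memv_pick.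
have x0 : x != 0 by rewrite vpick0.
exists x, (W :\: <[x]>)%VS; split.
- split=> //; last by rewrite wxx // expr0n.
  apply/negP => xD; case/eqP: x0; apply/eqP; rewrite -memv0 -(capv_diff W <[x]>).
  by rewrite memv_cap xD memv_line.
- exact: diffvSl.
- by rewrite -(dimv_cap_compl W <[x]>) addnC -addn1 leq_add2l
    (leq_trans (dimvS (capvSr _ _))) // dim_vline x0.
- by move=> z zD; apply: wW => //; apply: subvP zD; exact: diffvSl.
Qed.

End LinearAlgebra.

(** * Vector algebra in dimension three *)

Section ThreeSpace.
Context {R : realType}.
Implicit Types (u v x p q r : 'rV[R]_3).

Notation i0 := (@Ordinal 3 0 isT).
Notation i1 := (@Ordinal 3 1 isT).
Notation i2 := (@Ordinal 3 2 isT).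

Definition dot3 u v := u 0 i0 * v 0 i0 + u 0 i1 * v 0 i1 + u 0 i2 * v 0 i2.

Definition row3 (a b c : R) : 'rV[R]_3 := \row_i [:: a; b; c]`_i.

Definition cross3 u v : 'rV[R]_3 :=
  row3 (u 0 i1 * v 0 i2 - u 0 i2 * v 0 i1) (u 0 i2 * v 0 i0 - u 0 i0 * v 0 i2)
       (u 0 i0 * v 0 i1 - u 0 i1 * v 0 i0).

Definition triple3 p q r := dot3 p (cross3 q r).

Lemma row3P u v : u 0 i0 = v 0 i0 -> u 0 i1 = v 0 i1 -> u 0 i2 = v 0 i2 -> u = v.
Proof.
move=> e0 e1 e2; apply/rowP=> -[[|[|[|//]]] h].
- by rewrite (_ : Ordinal h = i0) //; apply: val_inj.
- by rewrite (_ : Ordinal h = i1) //; apply: val_inj.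
- by rewrite (_ : Ordinal h = i2) //; apply: val_inj.
Qed.

Lemma triple3C p q r : triple3 p q r = triple3 q r p.
Proof. by rewrite /triple3 /dot3 !mxE /=; ring. Qed.

Lemma cross3_cross p q r : cross3 (cross3 q r) (cross3 r p) = triple3 p q r *: r.
Proof. by apply: row3P; rewrite /triple3 /dot3 !mxE /= ?mxE /=; ring. Qed.

(** The cross products q x r, r x p, p x q are [triple3 p q r] times the dual basis of p, q, r. *)
Lemma triple3_expand p q r x : triple3 p q r *: x =
  dot3 x p *: cross3 q r + dot3 x q *: cross3 r p + dot3 x r *: cross3 p q.
Proof. by apply: row3P; rewrite /triple3 /dot3 !mxE /= ?mxE /=; ring. Qed.

Lemma triple3_neq0 p q r : free [:: p; q; r] -> triple3 p q r != 0.
Proof.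
move=> fr; pose A : 'M[R]_3 := \matrix_(i, j) ([:: p; q; r]`_i) 0 j.
have -> : triple3 p q r = \det A.
  rewrite (@det_mx33E _ _ (fun i j => ([:: p; q; r]`_i) 0 (inord j))); last first.
    by move=> i j; rewrite mxE inord_val.
  have e0 : inord 0 = i0 by apply: val_inj; rewrite /= inordK.
  have e1 : inord 1 = i1 by apply: val_inj; rewrite /= inordK.
  have e2 : inord 2 = i2 by apply: val_inj; rewrite /= inordK.
  by rewrite e0 e1 e2 /triple3 /dot3 !mxE /=; ring.
apply/negP => /det0P[v v0 vA]; case/eqP: v0; apply/rowP => i; rewrite mxE.
apply: (elimT (@freeP _ _ _ [tuple p; q; r]) fr (v 0)).
apply/rowP=> j; move/rowP/(_ j): vA; rewrite !mxE => vA.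
by rewrite summxE -[RHS]vA; apply: eq_bigr => k _; rewrite !mxE.
Qed.

(** Three uses of [orthogonal_step]; independence holds because each vector lies outside the
    subspace containing the later ones. *)
Lemma symmetric3_diag (M : 'M[R]_3) : M^T = M -> exists p q r,
  [/\ triple3 p q r != 0,
      [/\ dot3 (p *m M) p ^+ 3 = dot3 (p *m M) p,
          dot3 (q *m M) q ^+ 3 = dot3 (q *m M) q &
          dot3 (r *m M) r ^+ 3 = dot3 (r *m M) r],
      dot3 (p *m M) q = 0 /\ dot3 (p *m M) r = 0,
      dot3 (q *m M) p = 0 /\ dot3 (q *m M) r = 0 &
      dot3 (r *m M) p = 0 /\ dot3 (r *m M) q = 0].
Proof.
move=> MT; pose w u v := dot3 (u *m M) v.
have wl x : scalar (w^~ x).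
  by move=> a u v; rewrite /w /dot3 mulmxDl -scalemxAl !mxE /=; ring.
have wr x : scalar (w x) by move=> a u v; rewrite /w /dot3 !mxE; ring.
have wE u v : w u v = (u *m M *m v^T) 0 0.
  rewrite /w /dot3; move: (u *m M) => z; rewrite mxE !big_ord_recl big_ord0 !mxE addr0 addrA.
  by do !congr (_ + _); congr (_ * _); congr (fun_of_matrix _ _ _); apply: val_inj.
have wC u v : w u v = w v u.
  rewrite !wE; transitivity ((u *m M *m v^T)^T 0 0); first by rewrite [RHS]mxE.
  by rewrite !trmx_mul trmxK MT mulmxA.
have d3 : \dim {:'rV[R]_3} = 3%N by rewrite dimvf.
have nz W n : (n.+1 <= \dim W)%N -> W != 0%VS :> {vspace 'rV[R]_3}.
  by rewrite -dimv_eq0 -lt0n; apply: leq_trans.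
have [p [W1 [[pV pW p3] _ dW1 pW1]]] := orthogonal_step wl wr wC (nz fullv 2%N (eq_leq (esym d3))).
have dW1' : (2 <= \dim W1)%N by rewrite -ltnS; apply: leq_trans dW1; rewrite d3.
have [q [W2 [[qV qW q3] W21 dW2 qW2]]] := orthogonal_step wl wr wC (nz _ _ dW1').
have dW2' : (1 <= \dim W2)%N by rewrite -ltnS (leq_trans dW1').
have [r [W3 [[rV rW r3] _ _ _]]] := orthogonal_step wl wr wC (nz _ _ dW2').
have rV1 := subvP W21 _ rV.
exists p, q, r; split=> //.
- apply: triple3_neq0; rewrite !free_cons nil_free andbT span_nil memv0.
  apply/and3P; split.
  + by apply: contra pW; apply: subvP; apply/span_subvP => x; rewrite !inE => /orP[]/eqP->.
  + by apply: contra qW; apply: subvP; apply/span_subvP => x; rewrite !inE => /eqP->.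
  + by apply: contra rW => /eqP->; rewrite mem0v.
- by split; [exact: pW1 | exact: pW1].
- by split; [rewrite -[LHS]/(w _ _) wC; exact: pW1 | exact: qW2].
- by split; rewrite -[LHS]/(w _ _) wC; [exact: pW1 | exact: qW2].
Qed.

End ThreeSpace.

(** * The bracket as a 3 x 3 matrix, symmetric case *)

Section Normal43.
Context {R : realType} {V : vectType R}.
Variables (br : {bilinear V -> V -> V}).
Hypothesis dV : \dim {:V} = 7%N.
Hypothesis brxx : forall x, br x x = 0.

Notation i0 := (@Ordinal 3 0 isT).
Notation i1 := (@Ordinal 3 1 isT).
Notation i2 := (@Ordinal 3 2 isT).

Definition comb3 (f : 'I_3 -> V) (u : 'rV[R]_3) :=
  u 0 i0 *: f i0 + u 0 i1 *: f i1 + u 0 i2 *: f i2.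

Lemma comb3Z f a u : comb3 f (a *: u) = a *: comb3 f u.
Proof. by rewrite /comb3 !mxE -!scalerA -!scalerDr. Qed.

Lemma comb3D f u v : comb3 f (u + v) = comb3 f u + comb3 f v.
Proof.
by rewrite /comb3 !mxE !scalerDl [in RHS]addrACA [in X in _ = X + _]addrACA.
Qed.

Variables (f1 : V) (f : 'I_3 -> V).
Let z i := br f1 (f i).
Hypothesis z_central : forall i x, br (z i) x = 0.
Hypothesis z_free : forall u, comb3 z u = 0 -> u = 0.

Let brC := br_skew brxx.

Lemma br_comb3 u : br f1 (comb3 f u) = comb3 z u.
Proof. by rewrite /comb3 !linearDr /= !linearZr_LR. Qed.

Lemma comb3_central u x : br (comb3 z u) x = 0.
Proof. by rewrite /comb3 !linearDl /= !linearZl_LR /= !z_central !scaler0 !addr0. Qed.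

Lemma comb3_centralr u x : br x (comb3 z u) = 0.
Proof. by rewrite brC comb3_central oppr0. Qed.

(* The rows of [M] hold the brackets of the cyclic pairs, the middle one being [f2,f0]. *)
Lemma br_comb3_cross (M : 'M[R]_3) :
  br (f i1) (f i2) = comb3 z (row i0 M) -> br (f i2) (f i0) = comb3 z (row i1 M) ->
  br (f i0) (f i1) = comb3 z (row i2 M) ->
  forall u v, br (comb3 f u) (comb3 f v) = comb3 z (cross3 u v *m M).
Proof.
move=> b0 b1 b2 u v.
have -> : cross3 u v *m M = (cross3 u v) 0 i0 *: row i0 M
    + (cross3 u v) 0 i1 *: row i1 M + (cross3 u v) 0 i2 *: row i2 M.
  apply/rowP=> j; rewrite !mxE !big_ord_recl big_ord0 !mxE addr0 addrA.
  by do !congr (_ + _); congr (_ * _); congr (fun_of_matrix _ _ _); apply: val_inj.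
rewrite !comb3D !comb3Z -b0 -b1 -b2 {1 2}/comb3.
rewrite !(linearDl, linearDr) /= !(linearZl_LR, linearZr_LR) /= !brxx.
rewrite (brC (f i2) (f i1)) (brC (f i0) (f i2)) (brC (f i1) (f i0)) !mxE /=.
by apply: crd_ext => e; rewrite !(crdD, crdZ, crdN, crd0); ring.
Qed.

(** If p, q, r diagonalise M and t is their triple product, then (r x p) x (p x q) = t p, and t p M
    is a multiple of q x r. So the cross products, placed in both copies of 3-space, diagonalise the
    brackets. *)
Lemma coclosed_nilsoliton43_symmetric (M : 'M[R]_3) : M^T = M ->
  br (f i1) (f i2) = comb3 z (row i0 M) -> br (f i2) (f i0) = comb3 z (row i1 M) ->
  br (f i0) (f i1) = comb3 z (row i2 M) ->
  exists phi : cochain V 3,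
    [/\ is_G2_structure phi, is_coclosed br phi & induces_nilsoliton br phi].
Proof.
move=> MT b0 b1 b2.
have brM := br_comb3_cross b0 b1 b2.
have [p [q [r [t0 [p3 q3 r3] [pq pr] [qp qr] [rp rq]]]]] := symmetric3_diag MT.
set F := comb3 f; set Z := comb3 z.
pose b := [tuple f1; F (cross3 q r); F (cross3 r p); F (cross3 p q);
  Z (cross3 r p); Z (cross3 p q); Z (cross3 q r)].
have br_row x y1 y2 mu v : cross3 y1 y2 = triple3 p q r *: x ->
    triple3 p q r *: (x *m M) = mu *: v -> br (F y1) (F y2) = mu *: Z v.
  by move=> cE mE; rewrite brM cE -scalemxAl mE comb3Z.
(* Pairing with p, q and r isolates each coefficient times the triple product. *)
have zfree a1 a2 a3 : a1 *: Z (cross3 q r) + a2 *: Z (cross3 r p)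
    + a3 *: Z (cross3 p q) = 0 -> [/\ a1 = 0, a2 = 0 & a3 = 0].
  rewrite /Z -!comb3Z -!comb3D => /z_free x0.
  have E x : dot3 (a1 *: cross3 q r + a2 *: cross3 r p + a3 *: cross3 p q) x = 0.
    by rewrite x0 /dot3 !mxE; ring.
  have := E p; have := E q; have := E r.
  rewrite /dot3 !mxE /= => Er Eq Ep.
  split; apply: (mulIf t0); rewrite mul0r.
  - by rewrite -[RHS]Ep /triple3 /dot3 !mxE /=; ring.
  - by rewrite -[RHS]Eq /triple3 /dot3 !mxE /=; ring.
  - by rewrite -[RHS]Er /triple3 /dot3 !mxE /=; ring.
(* Bracketing a relation with f1 kills the three [F] coefficients, bracketing with F(q x r) then
   kills that of f1, and [zfree] handles the rest. *)
have freeb : free b.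
  apply/freeP => k; rewrite !(big_ord_recl, big_ord0) /= addr0 => k0.
  set k' := fun i : nat => k (inord i).
  have kE (i : 'I_7) : k i = k' i by rewrite /k' inord_val.
  rewrite !kE /= /bump /= in k0.
  have := congr1 (br f1) k0; rewrite linear0r !linearDr /= !linearZr_LR /= brxx.
  rewrite !br_comb3 !comb3_centralr !scaler0 add0r !addr0 addrA => /zfree[k1 k2 k3].
  move: k0; rewrite k1 k2 k3 !scale0r !add0r => k0.
  have := congr1 (br (F (cross3 q r))) k0; rewrite linear0r !linearDr /= !linearZr_LR /=.
  rewrite !comb3_centralr !scaler0 !addr0 brC br_comb3 scalerN -scaleNr.
  have := zfree (- k' 0%N) 0 0; rewrite !scale0r !addr0 => H /H[/eqP].
  rewrite oppr_eq0 => /eqP k00 _ _.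
  move: k0; rewrite k00 scale0r add0r addrA addrC addrA => /zfree[k6 k4 k5].
  by case=> [[|[|[|[|[|[|[|]]]]]]]] //= i7; rewrite kE.
have bb : basis_of fullv b by rewrite basisEfree freeb subvf dV.
have [e [eb be]] := basis_dual_exists dV bb.
apply: (@coclosed_nilsoliton43 _ _ br dV brxx b e (dot3 (p *m M) p) (dot3 (q *m M) q)
  (dot3 (r *m M) r) be eb) => //=.
- by move=> x; rewrite !comb3_central.
- by rewrite !br_comb3.
- split; [apply: (br_row p) | apply: (br_row q) | apply: (br_row r)].
  + by rewrite cross3_cross -(triple3C p).
  + by rewrite triple3_expand pq pr !scale0r !addr0.
  + by rewrite cross3_cross (triple3C r).
  + by rewrite triple3_expand qp qr !scale0r addr0 add0r.
  + exact: cross3_cross.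
  + by rewrite triple3_expand rp rq !scale0r !add0r.
Qed.

End Normal43.

(** * Removal of the skew part of the matrix *)

Section Shift43.
Context {R : realType} {V : vectType R}.
Variables (br : {bilinear V -> V -> V}).
Hypothesis dV : \dim {:V} = 7%N.
Hypothesis brxx : forall x, br x x = 0.

Notation i0 := (@Ordinal 3 0 isT).
Notation i1 := (@Ordinal 3 1 isT).
Notation i2 := (@Ordinal 3 2 isT).

(** Replacing f_i by f_i + t_i f1 keeps z_i = [f1,f_i] and adds t_i z_j - t_j z_i to [f_i,f_j],
    which changes the matrix by an arbitrary skew one. *)
Lemma coclosed_nilsoliton43_adjoint (f1 : V) (f : 'I_3 -> V) :
  let z i := br f1 (f i) in
  (forall i x, br (z i) x = 0) -> (forall u, comb3 z u = 0 -> u = 0) ->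
  (forall i j, exists u, br (f i) (f j) = comb3 z u) ->
  exists phi : cochain V 3,
    [/\ is_G2_structure phi, is_coclosed br phi & induces_nilsoliton br phi].
Proof.
move=> z zc zf brz.
have [u uE] := brz i1 i2; have [v vE] := brz i2 i0; have [w wE] := brz i0 i1.
(* The t_i solve the three equations that make [M] below symmetric. *)
pose t0 := (v 0 i2 - w 0 i1) / 2%:R.
pose t1 := (w 0 i0 - u 0 i2) / 2%:R.
pose t2 := (u 0 i1 - v 0 i0) / 2%:R.
pose f' (i : 'I_3) := f i + [:: t0; t1; t2]`_i *: f1.
have z'E i : br f1 (f' i) = z i by rewrite /f' linearDr /= linearZr_LR /= brxx scaler0 addr0.
have c3E s : comb3 (fun i => br f1 (f' i)) s = comb3 z s by rewrite /comb3 !z'E.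
have brC x y : br y x = - br x y by rewrite (br_skew brxx).
pose M : 'M[R]_3 := \matrix_(i, j) ([:: row3 (u 0 i0) (u 0 i1 - t2) (u 0 i2 + t1);
   row3 (v 0 i0 + t2) (v 0 i1) (v 0 i2 - t0);
   row3 (w 0 i0 - t1) (w 0 i1 + t0) (w 0 i2)]`_i) 0 j.
have e2 : (2%:R : R) != 0 by rewrite pnatr_eq0.
apply: (@coclosed_nilsoliton43_symmetric _ _ br dV brxx f1 f' _ _ M).
- by move=> i x; rewrite z'E.
- by move=> s; rewrite c3E; apply: zf.
- apply/matrixP => -[[|[|[|//]]] i3] [[|[|[|//]]] j3]; rewrite !mxE /= ?mxE //=;
    by rewrite /t0 /t1 /t2; field.
- rewrite c3E /f' /= !(linearDl, linearDr) /= !(linearZl_LR, linearZr_LR) /= brxx.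
  rewrite (brC f1 (f i1)) -!/(z _) uE.
  by apply: crd_ext => e; rewrite /comb3 !mxE /= ?mxE /= !(crdD, crdZ, crdN, crd0); ring.
- rewrite c3E /f' /= !(linearDl, linearDr) /= !(linearZl_LR, linearZr_LR) /= brxx.
  rewrite (brC f1 (f i2)) -!/(z _) vE.
  by apply: crd_ext => e; rewrite /comb3 !mxE /= ?mxE /= !(crdD, crdZ, crdN, crd0); ring.
- rewrite c3E /f' /= !(linearDl, linearDr) /= !(linearZl_LR, linearZr_LR) /= brxx.
  rewrite (brC f1 (f i0)) -!/(z _) wE.
  by apply: crd_ext => e; rewrite /comb3 !mxE /= ?mxE /= !(crdD, crdZ, crdN, crd0); ring.
Qed.

End Shift43.

(** * The centre and the derived algebra *)

Section Center.
Context {R : realType} {V : vectType R}.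
Variables (br : {bilinear V -> V -> V}).
Hypothesis dV : \dim {:V} = 7%N.
Hypothesis brxx : forall x, br x x = 0.
Hypothesis br_br : forall x y t, br x (br y t) = 0.
Hypothesis non_abelian : exists x y, br x y != 0.
Hypothesis indec : indecomposable br.

Let brC := br_skew brxx.

Lemma center_exists : exists Z : {vspace V}, forall x, x \in Z <-> forall y, br x y = 0.
Proof.
have [ad adE] := hom_of_bilinear (linearPr br) (linearPl br).
exists (lker ad) => x; split=> [|x0].
  by rewrite memv_ker => /eqP ad0 y; rewrite -adE ad0 zero_lfunE.
by rewrite memv_ker; apply/eqP/lfunP => y; rewrite adE x0 zero_lfunE.
Qed.

Lemma br_span (X : seq V) (S : {vspace V}) x y : x \in <<X>>%VS -> y \in <<X>>%VS ->
  (forall s t, s \in X -> t \in X -> br s t \in S) -> br x y \in S.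
Proof.
move=> xX yX brS; rewrite (coord_span (X := in_tuple X) xX) linear_sumlz.
apply: memv_suml => i _; rewrite linearZl_LR memvZ //.
rewrite (coord_span (X := in_tuple X) yX) linear_sumr.
apply: memv_suml => j _; rewrite linearZr_LR memvZ //.
by apply: brS; apply: mem_nth.
Qed.

Variable Z : {vspace V}.
Hypothesis ZP : forall x, x \in Z <-> forall y, br x y = 0.

(** If the centre were not inside D = [g,g], a complement C of their intersection in the centre
    would be a nonzero central ideal. Any subspace containing D is an ideal, so a complement of C
    containing D would decompose the algebra. *)
Lemma center_sub (S : {vspace V}) : (forall x y, br x y \in S) -> (Z <= S)%VS.
Proof.
move=> brS; pose X := vbasis {:V}.
pose D := <<[seq br s t | s <- X, t <- X]>>%VS.
have brD x y : br x y \in D.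
  apply: (@br_span X); rewrite ?(span_basis (vbasisP _)) ?memvf // => s t sX tX.
  by apply: memv_span; apply: allpairs_f.
have DS : (D <= S)%VS by apply/span_subvP => _ /allpairsP[[s t] [_ _ ->]].
apply: subv_trans DS; apply: contrapT => /negP ZD; apply: indec.
pose C := (Z :\: D)%VS; exists C, (D + (C + D)^C)%VS; split.
- split=> x y; last by move=> _; apply: subvP (brD x y); exact: addvSl.
  move=> yC; have yZ : y \in Z by apply: subvP yC; exact: diffvSl.
  by rewrite brC ((ZP _).1 yZ) oppr0 mem0v.
- split; last first.
    have [x [y xy]] := non_abelian; apply: contra_neq xy => J0.
    by apply/eqP; rewrite -memv0 -J0; apply: subvP (brD x y); exact: addvSl.
  apply: contraNneq ZD => C0; rewrite -(addv_diff_cap Z D) -/C C0 add0v.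
  exact: capvSr.
- by rewrite addvA addv_complf.
- apply/eqP; rewrite -subv0; apply/subvP => x; rewrite memv_cap => /andP[xC].
  move=> /memv_addP[d dD [k kK xE]].
  have k0 : k = 0.
    apply/eqP; rewrite -memv0 -(capv_compl (C + D)%VS) memv_cap kK andbT.
    have -> : k = x - d by rewrite xE addrC addKr.
    by rewrite rpredB //; [apply: subvP xC; exact: addvSl | apply: subvP dD; exact: addvSr].
  by rewrite -(capv_diff Z D) memv_cap xC xE k0 addr0.
Qed.

Lemma br_center x y : br x y \in Z.
Proof. by apply/ZP => t; rewrite brC br_br oppr0. Qed.

Let U := (Z^C)%VS.

Lemma center_decomp x : exists2 u, u \in U & x - u \in Z.
Proof.
have : x \in (Z + U)%VS by rewrite addv_complf memvf.
by case/memv_addP=> zx zZ [u uU ->]; exists u => //; rewrite addrK.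
Qed.

Lemma br_mod_center x x' y y' : x - x' \in Z -> y - y' \in Z -> br x y = br x' y'.
Proof.
move=> /ZP xx /ZP yy; apply/eqP; rewrite -subr_eq0.
have -> : br x y - br x' y' = br (x - x') y + br x' (y - y').
  by rewrite linearBl linearBr /= addrA subrK.
by rewrite xx add0r brC yy oppr0.
Qed.

(** Brackets depend only on classes modulo the centre, so generators of [U] suffice. *)
Lemma center_le_brackets (X : seq V) (S : {vspace V}) : (U <= <<X>>)%VS ->
  (forall s t, s \in X -> t \in X -> br s t \in S) -> (Z <= S)%VS.
Proof.
move=> UX brS; apply: center_sub => x y.
have [u uU xu] := center_decomp x; have [v vU yv] := center_decomp y.
rewrite (br_mod_center xu yv); apply: br_span brS; exact: (subvP UX).
Qed.

Lemma center_cap u : u \in U -> (forall v, v \in U -> br u v = 0) -> u = 0.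
Proof.
move=> uU u0; apply/eqP; rewrite -memv0 -(capv_compl Z) memv_cap uU andbT.
apply/ZP => y; have [v vU yv] := center_decomp y.
by rewrite (br_mod_center (_ : u - u \in Z) yv) ?u0 // subrr mem0v.
Qed.

Lemma dim_center_compl : (\dim Z + \dim U)%N = 7%N.
Proof. by rewrite -dV -(addv_complf Z) dimv_disjoint_sum // capv_compl. Qed.

Lemma br_three a b c s t : s \in [:: a; b; c] -> t \in [:: a; b; c] ->
  br s t \in <<[:: br a b; br a c; br b c]>>%VS.
Proof.
have ab : br a b \in <<[:: br a b; br a c; br b c]>>%VS by rewrite memv_span ?mem_head.
have ac : br a c \in <<[:: br a b; br a c; br b c]>>%VS.
  by rewrite memv_span // in_cons mem_head orbT.
have bc : br b c \in <<[:: br a b; br a c; br b c]>>%VS.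
  by rewrite memv_span // !in_cons eqxx !orbT.
have ba := ab; have ca := ac; have cb := bc.
rewrite -memvN -brC in ba; rewrite -memvN -brC in ca; rewrite -memvN -brC in cb.
by rewrite !inE => /or3P[]/eqP-> /or3P[]/eqP->; rewrite ?brxx ?mem0v.
Qed.

(** If dim Z were at least 4, then dim U would be at most 3, and the three brackets of its
    generators could not span Z. *)
Lemma dim_center : [\/ \dim Z = 1, \dim Z = 2 | \dim Z = 3]%N.
Proof.
have Z0 : (0 < \dim Z)%N.
  rewrite lt0n dimv_eq0; have [x [y xy]] := non_abelian.
  by apply: contra_neq xy => Z0; apply/eqP; rewrite -memv0 -Z0 br_center.
suff : (\dim Z <= 3)%N.
  by move: Z0; case: (\dim Z) => [|[|[|[|]]]] // *; [constructor 1|constructor 2|constructor 3].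
have dZU := dim_center_compl.
case: (leqP (\dim Z) 3) => // Z4.
have U3 : (\dim U <= 3)%N by rewrite -(leq_add2l 4) -[(4 + 3)%N]/7%N -dZU leq_add2r.
(* When dim U < 3 the missing entries default to 0, which is harmless in a spanning list. *)
pose X := [:: (vbasis U)`_0; (vbasis U)`_1; (vbasis U)`_2].
have UX : (U <= <<X>>)%VS.
  rewrite -{1}(span_basis (vbasisP U)); apply/span_subvP => x xU.
  rewrite -(nth_index 0 xU); move: xU; rewrite -index_mem size_tuple => xU.
  have := leq_trans xU U3.
  by case: (index _ _) => [|[|[|]]] // _; apply: memv_span; rewrite !inE eqxx ?orbT.
have /dimvS ZY := center_le_brackets UX (@br_three _ _ _).
by have := leq_trans (leq_trans Z4 ZY) (dim_span _).
Qed.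

End Center.

Lemma basis_tuple (K : fieldType) (V : vectType K) (W : {vspace V}) n :
  \dim W = n -> exists X : n.-tuple V, basis_of W X.
Proof. by move=> <-; exists (vbasis W); apply: vbasisP. Qed.

(** * The three possible dimensions of the centre *)

Section Cases.
Context {R : realType} {V : vectType R}.
Variables (br : {bilinear V -> V -> V}).
Hypothesis dV : \dim {:V} = 7%N.
Hypothesis brxx : forall x, br x x = 0.
Hypothesis br_br : forall x y t, br x (br y t) = 0.
Hypothesis non_abelian : exists x y, br x y != 0.
Hypothesis indec : indecomposable br.
Variable Z : {vspace V}.
Hypothesis ZP : forall x, x \in Z <-> forall y, br x y = 0.

Let brC := br_skew brxx.
Let U := (Z^C)%VS.

Lemma one_dim_center : \dim Z = 1%N -> exists phi : cochain V 3,
    [/\ is_G2_structure phi, is_coclosed br phi & induces_nilsoliton br phi].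
Proof.
move=> dZ; have [X bX] := basis_tuple dZ; pose p := X`_0.
pose w x y : R := coord X ord0 (br x y).
have pZ : p \in Z by apply: (basis_mem bX); rewrite mem_nth ?size_tuple.
have p0 : p != 0 by apply: (free_not0 (basis_free bX)); rewrite mem_nth ?size_tuple.
have brw x y : br x y = w x y *: p.
  have := coord_basis bX (br_center brxx br_br ZP x y).
  by rewrite big_ord_recl big_ord0 addr0.
have wl x : scalar (w^~ x) by move=> a u v; rewrite /w linearPl linearP.
have wr x : scalar (w x) by move=> a u v; rewrite /w linearPr linearP.
have wxx x : w x x = 0 by rewrite /w brxx linear0.
have dU : \dim U = 6%N by have := dim_center_compl dV Z; rewrite dZ => -[].
have nd : nondegenerate_on w U.
  move=> x xU x0; apply: (center_cap brxx ZP xU) => y yU.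
  by rewrite brw x0 // scale0r.
have nz (W : {vspace V}) n : (n.+1 <= \dim W)%N -> W != 0%VS.
  by rewrite -dimv_eq0 -lt0n; apply: leq_trans.
have [x1 [y1 [W1 [[x1U y1U x1y1] W1U dW1 nd1 o1]]]] :=
  darboux_step wl wr wxx nd (nz U 5%N (eq_leq (esym dU))).
have dW1' : (4 <= \dim W1)%N by rewrite -2!ltnS; apply: leq_trans dW1; rewrite dU.
have [x2 [y2 [W2 [[x2W y2W x2y2] W21 dW2 nd2 o2]]]] :=
  darboux_step wl wr wxx nd1 (nz _ _ dW1').
have dW2' : (2 <= \dim W2)%N by rewrite -2!ltnS; apply: leq_trans dW2.
have [x3 [y3 [W3 [[x3W y3W x3y3] _ _ _ _]]]] :=
  darboux_step wl wr wxx nd2 (nz _ _ dW2').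
have brp x y : w x y = 1 -> br x y = p by rewrite brw => ->; rewrite scale1r.
have br0 x y : w x y = 0 -> br x y = 0 by rewrite brw => ->; rewrite scale0r.
have [z12 z13] := o1 _ x2W; have [z14 z15] := o1 _ y2W.
have [z22 z23] := o1 _ (subvP W21 _ x3W); have [z24 z25] := o1 _ (subvP W21 _ y3W).
have [z32 z33] := o2 _ x3W; have [z34 z35] := o2 _ y3W.
have rules := (brp _ _ x1y1, brp _ _ x2y2, brp _ _ x3y3,
  (br0 _ _ z12, br0 _ _ z13, br0 _ _ z14, br0 _ _ z15),
  (br0 _ _ z22, br0 _ _ z23, br0 _ _ z24, br0 _ _ z25),
  (br0 _ _ z32, br0 _ _ z33, br0 _ _ z34, br0 _ _ z35)).
have rules' := (brC y1 x1, brC y2 x2, brC y3 x3,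
  (brC x2 x1, brC x2 y1, brC y2 x1, brC y2 y1),
  (brC x3 x1, brC x3 y1, brC y3 x1, brC y3 y1),
  (brC x3 x2, brC x3 y2, brC y3 x2, brC y3 y2)).
have pc x : br p x = 0 by apply: (ZP p).1.
have pc' x : br x p = 0 by rewrite brC pc oppr0.
pose b := [tuple x1; y1; x2; y2; x3; y3; p].
(* Bracketing a relation with a Darboux vector isolates the coefficient of its partner. *)
have freeb : free b.
  apply/freeP => k; rewrite !(big_ord_recl, big_ord0) /= addr0 => k0.
  set k' := fun i : nat => k (inord i).
  have kE (i : 'I_7) : k i = k' i by rewrite /k' inord_val.
  rewrite !kE /= /bump /= in k0.
  have H x := congr1 (br x) k0.
  have K x : br x 0 = 0 by exact: linear0r.
  have pz c : c *: p = 0 -> c = 0.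
    by move=> /eqP; rewrite scaler_eq0 (negbTE p0) orbF => /eqP.
  have pz' c : - c *: p = 0 -> c = 0 by move/pz/eqP; rewrite oppr_eq0 => /eqP.
  have k1 : k' 1%N = 0.
    have := H x1; rewrite K !linearDr /= !linearZr_LR /= brxx pc' !rules !scaler0 !addr0 add0r.
    exact: pz.
  have k00 : k' 0%N = 0.
    have := H y1; rewrite K !linearDr /= !linearZr_LR /= brxx pc' rules' !rules !scaler0 !addr0.
    by rewrite scalerN -scaleNr; exact: pz'.
  have k3 : k' 3%N = 0.
    have := H x2; rewrite K !linearDr /= !linearZr_LR /= brxx pc'.
    rewrite !rules' !rules !oppr0 !scaler0 !addr0 !add0r.
    exact: pz.
  have k2 : k' 2%N = 0.
    have := H y2; rewrite K !linearDr /= !linearZr_LR /= brxx pc'.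
    rewrite !rules' !rules !oppr0 !scaler0 !addr0 !add0r.
    by rewrite scalerN -scaleNr; exact: pz'.
  have k5 : k' 5%N = 0.
    have := H x3; rewrite K !linearDr /= !linearZr_LR /= brxx pc'.
    rewrite !rules' !rules !oppr0 !scaler0 !addr0 !add0r.
    exact: pz.
  have k4 : k' 4%N = 0.
    have := H y3; rewrite K !linearDr /= !linearZr_LR /= brxx pc'.
    rewrite !rules' !rules !oppr0 !scaler0 !addr0 !add0r.
    by rewrite scalerN -scaleNr; exact: pz'.
  move: k0; rewrite k00 k1 k2 k3 k4 k5 !scale0r !add0r => /pz k6.
  by case=> [[|[|[|[|[|[|[|]]]]]]]] //= i7; rewrite kE.
have bb : basis_of fullv b by rewrite basisEfree freeb subvf dV.
have [e [eb be]] := basis_dual_exists dV bb.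
apply: (coclosed_nilsoliton61 dV brxx be eb) => x y.
apply: (crd_inj be) => k; rewrite (crd_br_frame _ _ _ _ be) !(big_ord_recr, big_ord0) /=.
rewrite !brxx !pc !pc' !rules' !rules !oppr0 crdZ !crdN !crd0 /symplectic61; ring.
Qed.

Lemma two_dim_center (phi : cochain V 3) : \dim Z = 2%N -> ~ is_coclosed br phi.
Proof.
move=> dZ /(coclosed_frame dV)[e [b [be closed]]].
have [X bX] := basis_tuple dZ.
pose p := X`_0; pose q := X`_1; pose o1 := @Ordinal 2 1 isT.
have pZ : p \in Z by apply: (basis_mem bX); rewrite mem_nth ?size_tuple.
have qZ : q \in Z by apply: (basis_mem bX); rewrite mem_nth ?size_tuple.
have p0 : p != 0 by apply: (free_not0 (basis_free bX)); rewrite mem_nth ?size_tuple.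
have ZE x : x \in Z -> x = coord X ord0 x *: p + coord X o1 x *: q.
  move=> /(coord_basis bX) {1}->; rewrite !big_ord_recl big_ord0 addr0.
  by congr (_ + _); congr (coord X _ _ *: _); apply: val_inj.
have brE x y := ZE _ (br_center brxx br_br ZP x y).
have g0 : gram e p q != 0.
  apply: (gram_neq0 be) p0 => s t st.
  apply: (elimT (@freeP _ _ _ X) (basis_free bX) (fun i => [:: s; t]`_i) _ o1).
  by rewrite !big_ord_recl big_ord0 addr0.
have gC : gram e q p = gram e p q by rewrite /gram (dotC e q p); ring.
(* [closed_cross] controls the q-component of the bracket. Exchanging p and q gives the p-component,
   and u only changes sign. *)
have crossC : cross e b q p = - cross e b p q.
  apply: (crd_inj be) => k; rewrite crdN !(crd_cross be) // /cross_crd /det2.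
  by case: k => [[|[|[|[|[|[|[|]]]]]]]] //= _; ring.
have pc := (ZP p).1 pZ; have qc := (ZP q).1 qZ.
have u1 x : coord X o1 (br x (cross e b p q)) = 0.
  apply: (closed_cross be (h := coord X o1) x closed brxx pc qc) g0 => y t.
  by exists (coord X ord0 (br y t)); exact: brE.
have u0 x : coord X ord0 (br x (cross e b p q)) = 0.
  rewrite -[cross e b p q]opprK -crossC linearNr linearN; apply/eqP; rewrite oppr_eq0.
  apply/eqP; apply: (closed_cross be (h := coord X ord0) x closed brxx qc pc).
    by move=> y t; exists (coord X o1 (br y t)); rewrite addrC; exact: brE.
  by rewrite gC.
have uZ : cross e b p q \in Z.
  by apply/ZP => x; rewrite brC brE u0 u1 !scale0r addr0 oppr0.
(* Being central, u is a combination of p and q, to which it is orthogonal; so |u|^2 = [gram e p q]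
   would be 0. *)
case/eqP: g0; rewrite -(dot_cross be) {2}(ZE _ uZ) dotPr.
have dZ' a x y : dot e x (a *: y) = a * dot e x y.
  by rewrite /dot mulr_sumr; apply: eq_bigr => i _; rewrite crdZ; ring.
by rewrite dZ' (dot_crossl be) (dot_crossr be) !mulr0 addr0.
Qed.

Definition regular v := v \in U /\ forall w, w \in U -> br v w = 0 -> w \in <[v]>%VS.

Lemma span3P (a b c x : V) : x \in <<[:: a; b; c]>>%VS ->
  exists s t u, x = s *: a + t *: b + u *: c.
Proof.
rewrite !span_cons span_nil addv0 => /memv_addP[_ /vlineP[s ->] [y]].
move=> /memv_addP[_ /vlineP[t ->] [_ /vlineP[u ->] ->]] ->.
by exists s, t, u; rewrite addrA.
Qed.

Lemma span4P (a b c d x : V) : x \in <<[:: a; b; c; d]>>%VS ->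
  exists s t u r, x = s *: a + t *: b + u *: c + r *: d.
Proof.
rewrite span_cons => /memv_addP[_ /vlineP[s ->] [y /span3P[t [u [r ->]]] ->]].
by exists s, t, u, r; rewrite !addrA.
Qed.

Lemma free3P (a b c : V) s t u : free [:: a; b; c] ->
  s *: a + t *: b + u *: c = 0 -> [/\ s = 0, t = 0 & u = 0].
Proof.
move=> fr E; pose k (i : 'I_3) : R := [:: s; t; u]`_i.
have K := elimT (@freeP _ _ _ [tuple a; b; c]) fr k.
have k0 : \sum_(i < 3) k i *: [tuple a; b; c]`_i = 0.
  by rewrite !big_ord_recl big_ord0 addr0 addrA.
split; [exact: (K k0 (@Ordinal 3 0 isT)) | exact: (K k0 (@Ordinal 3 1 isT))
  | exact: (K k0 (@Ordinal 3 2 isT))].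
Qed.

Section ThreeDim.
Hypothesis dZ : \dim Z = 3%N.

Let dU : \dim U = 4%N.
Proof. by have := dim_center_compl dV Z; rewrite dZ => -[]. Qed.

(* With x_ij = [p_i,q_j], the bracket of p2 + q2 with s p1 + t p2 + u q1 + r q2 is
   -s x12 + u x21 + (r - t) x22. *)
Lemma regular_sum (p1 p2 q1 q2 : V) : p2 \in U -> q2 \in U ->
  (U <= <<[:: p1; p2; q1; q2]>>)%VS -> br p1 p2 = 0 -> br q1 q2 = 0 ->
  br p1 q1 \in <<[:: br p1 q2; br p2 q1; br p2 q2]>>%VS -> regular (p2 + q2).
Proof.
move=> p2U q2U UX p12 q12 x11; set S := <<_>>%VS in x11.
have x12 : br p1 q2 \in S by rewrite memv_span ?mem_head.
have x21 : br p2 q1 \in S by rewrite memv_span // in_cons mem_head orbT.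
have x22 : br p2 q2 \in S by rewrite memv_span // !in_cons eqxx !orbT.
(* [S] contains every bracket, hence the 3-dimensional centre; its three generators are therefore
   independent. *)
have ZS : (Z <= S)%VS.
  apply: (center_le_brackets brxx non_abelian indec ZP UX).
  have y11 := x11; have y12 := x12; have y21 := x21; have y22 := x22.
  rewrite -memvN -brC in y11; rewrite -memvN -brC in y12.
  rewrite -memvN -brC in y21; rewrite -memvN -brC in y22.
  have p21 : br p2 p1 = 0 by rewrite brC p12 oppr0.
  have q21 : br q2 q1 = 0 by rewrite brC q12 oppr0.
  move=> s t; rewrite !inE => /or4P[]/eqP-> /or4P[]/eqP->;
    by rewrite ?brxx ?p12 ?p21 ?q12 ?q21 ?mem0v.
have fr : free [:: br p1 q2; br p2 q1; br p2 q2] by apply: free_of_span ZS _; rewrite dZ.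
split=> [|w wU]; first by rewrite rpredD.
have [s [t [u [r ->]]]] := span4P (subvP UX _ wU).
rewrite linearDl !linearDr /= !linearZr_LR /= !brxx (brC q2 q1) q12 (brC p2 p1) p12.
rewrite (brC q2 p1) (brC q2 p2) => E.
have /(free3P fr)[s0 u0 rt] : - s *: br p1 q2 + u *: br p2 q1 + (r - t) *: br p2 q2 = 0.
  by rewrite -[RHS]E; apply: crd_ext => e; rewrite !(crdD, crdZ, crdN, crd0); ring.
have -> : r = t by apply/eqP; rewrite -subr_eq0 rt.
have -> : s = 0 by apply/eqP; rewrite -oppr_eq0 s0.
by rewrite u0 !scale0r add0r addr0 -scalerDr memvZ ?memv_line.
Qed.

(** The four brackets [p_i,q_j] lie in a 3-dimensional space, so one of them is a combination of
    those after it. Relabelling makes it [p1,q1], and [regular_sum] applies. *)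
Lemma two_abelian_planes (p1 p2 q1 q2 : V) :
  all (mem U) [:: p1; p2; q1; q2] -> (U <= <<[:: p1; p2; q1; q2]>>)%VS ->
  br p1 p2 = 0 -> br q1 q2 = 0 -> exists v, regular v.
Proof.
case/and5P=> p1U p2U q1U q2U _ UX p12 q12.
have p21 : br p2 p1 = 0 by rewrite brC p12 oppr0.
have q21 : br q2 q1 = 0 by rewrite brC q12 oppr0.
have brZ x y : br x y \in Z := br_center brxx br_br ZP x y.
have U1 : (U <= <<[:: p1; p2; q2; q1]>>)%VS.
  by rewrite (eq_span (Y := [:: p1; p2; q1; q2])) // => x; rewrite !inE [(x == q2) || _]orbC.
have U2 : (U <= <<[:: p2; p1; q1; q2]>>)%VS.
  by rewrite (eq_span (Y := [:: p1; p2; q1; q2])) // => x; rewrite !inE orbCA.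
have U3 : (U <= <<[:: p2; p1; q2; q1]>>)%VS.
  by rewrite (eq_span (Y := [:: p1; p2; q2; q1])) // => x; rewrite !inE orbCA.
have sub (X Y : seq V) : {subset X <= Y} -> (<<X>> <= <<Y>>)%VS := @sub_span _ _ X Y.
have : ~~ free [:: br p1 q1; br p1 q2; br p2 q1; br p2 q2].
  apply/negP => /eqnP fr.
  have : (<<[:: br p1 q1; br p1 q2; br p2 q1; br p2 q2]>> <= Z)%VS.
    by apply/span_subvP => x; rewrite !inE => /or4P[]/eqP->; apply: brZ.
  by move/dimvS; rewrite fr dZ.
rewrite !free_cons nil_free andbT span_nil !negb_and !negbK.
case/or4P=> xX.
- by exists (p2 + q2); apply: regular_sum UX _ _ _.
- exists (p2 + q1); apply: (regular_sum p2U q1U U1) => //.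
  apply: subvP xX; apply: sub => x.
  by rewrite !inE => /orP[]/eqP->; rewrite eqxx ?orbT.
- exists (p1 + q2); apply: (regular_sum p1U q2U U2) => //.
  by apply: subvP xX; apply: sub => x; rewrite !inE => /eqP->; rewrite eqxx.
- exists (p1 + q1); apply: (regular_sum p1U q1U U3) => //.
  by move: xX; rewrite memv0 => /eqP->; rewrite mem0v.
Qed.

(* Otherwise every v in U commutes with an independent w.  Starting from a commuting pair
   f1, f2, two further vectors f3, f4 either yield complementary commuting planes, or
   commute with g3, g4 in <f1,f2>; the planes <f3,g3>, <f4,g4> are then complementary
   unless g3 is central. *)
Lemma regular_exists : exists v, regular v.
Proof.
apply: contrapT => no.
have bad v : v \in U -> exists w, [/\ w \in U, br v w = 0 & w \notin <[v]>%VS].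
  move=> vU; apply: contrapT => H; apply: no; exists v; split=> // w wU vw.
  by apply: contrapT => /negP wv; apply: H; exists w.
have Uspan (a b c d : V) : all (mem U) [:: a; b; c; d] -> free [:: a; b; c; d] ->
    (U <= <<[:: a; b; c; d]>>)%VS.
  move=> aU fr; rewrite (span_of_free (W := U)) ?dU //.
  by apply/span_subvP => x xX; exact: (allP aU).
have [f1 f1U f10] : exists2 x, x \in U & x \notin <<[::]>>%VS.
  by apply: vspace_extend; rewrite dU.
have [f2 [f2U f12 f21]] := bad _ f1U.
have fr2 : free [:: f2; f1] by rewrite !free_cons nil_free span_seq1 f21 f10.
have commuting f3 : f3 \in U -> f3 \notin <<[:: f2; f1]>>%VS ->
    exists g, [/\ g \in <<[:: f2; f1]>>%VS, g != 0 & br f3 g = 0].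
  move=> f3U f3n; have [w [wU f3w wn]] := bad _ f3U.
  (* A partner w outside <f3,f2,f1> gives the complementary planes <w,f3> and <f2,f1>; otherwise
     removing its f3-component leaves g. *)
  have [win|wnot] := boolP (w \in <<[:: f3; f2; f1]>>%VS); last first.
    case: no; apply: (@two_abelian_planes w f3 f2 f1).
    - by rewrite /= wU f3U f2U f1U.
    - apply: Uspan; first by rewrite /= wU f3U f2U f1U.
      by rewrite free_cons wnot free_cons f3n fr2.
    - by rewrite brC f3w oppr0.
    - by rewrite brC f12 oppr0.
  move: win; rewrite span_cons => /memv_addP[_ /vlineP[s ->] [g gP wE]].
  exists g; split=> //.
    by apply: contraNneq wn => g0; rewrite wE g0 addr0 memvZ ?memv_line.
  by rewrite -f3w wE linearDr /= linearZr_LR /= brxx scaler0 add0r.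
have PU : (<<[:: f2; f1]>> <= U)%VS.
  by apply/span_subvP => x; rewrite !inE => /orP[]/eqP->.
have [f3 f3U f3n] : exists2 x, x \in U & x \notin <<[:: f2; f1]>>%VS.
  by apply: vspace_extend; rewrite dU.
have [g3 [g3P g30 f3g3]] := commuting _ f3U f3n.
have [f4 f4U f4n] : exists2 x, x \in U & x \notin <<[:: f3; f2; f1]>>%VS.
  by apply: vspace_extend; rewrite dU.
have f4n' : f4 \notin <<[:: f2; f1]>>%VS.
  by apply: contra f4n; apply: subvP; rewrite [X in (_ <= X)%VS]span_cons addvSr.
have [g4 [g4P g40 f4g4]] := commuting _ f4U f4n'.
have U4 : (U <= <<[:: f4; f3; f2; f1]>>)%VS.
  apply: Uspan; first by rewrite /= f1U f2U f3U f4U.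
  by rewrite free_cons f4n free_cons f3n fr2.
have [/vlineP[c g4E]|g4n] := boolP (g4 \in <[g3]>%VS).
  have c0 : c != 0 by apply: contra_neq g40 => c0; rewrite g4E c0 scale0r.
  have f4g3 : br f4 g3 = 0.
    move: f4g4; rewrite g4E linearZr_LR /= => /eqP.
    by rewrite scaler_eq0 (negbTE c0) => /eqP.
  case/eqP: g30; apply: (center_cap brxx ZP (subvP PU _ g3P)) => v vU.
  have [s [t [u [r ->]]]] := span4P (subvP U4 _ vU).
  have [g31 g32] : br g3 f1 = 0 /\ br g3 f2 = 0.
    move: g3P; rewrite span_cons span_seq1 => /memv_addP[_ /vlineP[a ->] [_ /vlineP[b ->] ->]].
    by rewrite !linearDl /= !linearZl_LR /= !brxx f12 brC f12 oppr0 !scaler0 addr0.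
  rewrite !linearDr /= !linearZr_LR /= g31 g32 (brC g3 f4) (brC g3 f3) f4g3 f3g3.
  by rewrite oppr0 !scaler0 !addr0.
have gspan : <<[:: g4; g3]>>%VS = <<[:: f2; f1]>>%VS.
  apply: span_of_free.
  - by apply/span_subvP => x; rewrite !inE => /orP[]/eqP->.
  - by rewrite !free_cons nil_free span_seq1 g4n span_nil memv0 g30.
  - by rewrite (eqnP fr2).
apply: no; apply: (@two_abelian_planes f3 g3 f4 g4) => //.
  by rewrite /= f3U f4U (subvP PU _ g3P) (subvP PU _ g4P).
apply: subv_trans U4 _.
have gS : (<<[:: f2; f1]>> <= <<[:: f3; g3; f4; g4]>>)%VS.
  rewrite -gspan; apply: sub_span => x.
  by rewrite !inE => /orP[]/eqP->; rewrite eqxx ?orbT.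
apply/span_subvP => x; rewrite !inE => /or4P[]/eqP->.
- by apply: memv_span; rewrite !inE eqxx ?orbT.
- by apply: memv_span; rewrite !inE eqxx ?orbT.
- by apply: (subvP gS); rewrite memv_span // mem_head.
- by apply: (subvP gS); rewrite memv_span // !inE eqxx orbT.
Qed.

Lemma three_dim_center : exists phi : cochain V 3,
    [/\ is_G2_structure phi, is_coclosed br phi & induces_nilsoliton br phi].
Proof.
have [v [vU vreg]] := regular_exists.
have v0 : v != 0.
  apply: contra_eq_neq dU => v0; have : (U <= 0)%VS.
    apply/subvP => w wU; have := vreg w wU; rewrite v0 linear0l => /(_ erefl).
    by case/vlineP=> k ->; rewrite scaler0 mem0v.
  by rewrite subv0 -dimv_eq0 => /eqP->.
(* [T] is a complement of v in U, on which ad v is injective by regularity; so it maps a basis of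
   [T] to a basis of Z. *)
pose T := (U :\: <[v]>)%VS.
have dT : \dim T = 3%N.
  have := dimv_cap_compl U <[v]>; rewrite dU (_ : U :&: <[v]> = <[v]>)%VS.
    by rewrite dim_vline v0 add1n => -[].
  by apply/capv_idPr; rewrite -memvE.
have [X bX] := basis_tuple dT.
have TX (i : 'I_3) : X`_i \in T by apply: (basis_mem bX); rewrite mem_nth ?size_tuple.
have TU : (T <= U)%VS by exact: diffvSl.
pose f (i : 'I_3) := X`_i; pose z i := br v (f i).
have zf u : comb3 z u = 0 -> u = 0.
  rewrite -[comb3 z u](br_comb3 br v f) => zu.
  have cT : comb3 f u \in T by rewrite !rpredD ?memvZ ?TX.
  have cv := vreg _ (subvP TU _ cT) zu.
  have c0 : comb3 f u = 0.
    by apply/eqP; rewrite -memv0 -(capv_diff U <[v]>) memv_cap cT cv.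
  apply/rowP => i; rewrite mxE.
  apply: (elimT (@freeP _ _ _ X) (basis_free bX) (u 0)).
  rewrite !big_ord_recl big_ord0 addr0 addrA -[RHS]c0 /comb3.
  by do !congr (_ + _); congr (_ *: _); rewrite /f; do ?congr (fun_of_matrix _ _ _);
    do ?congr (nth _ _ _); do ?apply: val_inj.
apply: (@coclosed_nilsoliton43_adjoint _ _ br dV brxx v f) => // [i x|i j].
  exact: ((ZP _).1 (br_center brxx br_br ZP _ _)).
have fr : free [:: z (@Ordinal 3 0 isT); z (@Ordinal 3 1 isT); z (@Ordinal 3 2 isT)].
  apply/(@freeP _ _ _ [tuple z (@Ordinal 3 0 isT); z (@Ordinal 3 1 isT); z (@Ordinal 3 2 isT)]).
  move=> k; rewrite !big_ord_recl big_ord0 addr0 addrA /= => k0 l.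
  have /rowP/(_ l) : \row_i k i = 0.
    apply: zf; rewrite -[RHS]k0 /comb3 !mxE.
    by do !congr (_ + _); congr (k _ *: _); apply: val_inj.
  by rewrite !mxE.
have zZ : <<[:: z (@Ordinal 3 0 isT); z (@Ordinal 3 1 isT); z (@Ordinal 3 2 isT)]>>%VS = Z.
  apply: span_of_free fr _; last by rewrite dZ.
  by apply/span_subvP => x; rewrite !inE => /or3P[]/eqP->; apply: br_center.
have := br_center brxx br_br ZP (f i) (f j).
rewrite -zZ => /span3P[s [t [u ->]]].
by exists (row3 s t u); rewrite /comb3 !mxE.
Qed.

End ThreeDim.

End Cases.

Theorem theorem17 (R : realType) (V : vectType R)
    (br : {bilinear V -> V -> V}) :
  is_lie_bracket br ->
  \dim {:V} = 7%N ->
  indecomposable br ->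
  two_step_nilpotent br ->
  (exists phi : cochain V 3, is_G2_structure phi /\ is_coclosed br phi) ->
  exists phi : cochain V 3,
    [/\ is_G2_structure phi, is_coclosed br phi & induces_nilsoliton br phi].
Proof.
move=> [brxx _] dV indec [nab nil] [phi [_ phi_coclosed]].
have [Z ZP] := center_exists br.
case: (dim_center dV brxx nil nab indec ZP) => dZ.
- exact: (one_dim_center dV brxx nil ZP dZ).
- by case: (two_dim_center dV brxx nil ZP dZ phi_coclosed).
- exact: (three_dim_center dV brxx nil nab indec ZP dZ).
Qed.
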